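(* (Gauge-invariant uniqueness theorem.) Let $\Lambda$ be a row-finite $k$-graph with no sources, and fix $c\in\underline{Z}^2(\Lambda,\mathbb{T})$. Let $t:\Lambda\to B$ be a Cuntz--Krieger $(\Lambda,c)$-family in a $C^*$-algebra $B$. Suppose that there is a strongly continuous action $\beta$ of $\mathbb{T}^k$ on $B$ satisfying $\beta_z(t_\lambda)=z^{d(\lambda)}t_\lambda$ for all $\lambda\in\Lambda$ and $z\in\mathbb{T}^k$. Then the induced homomorphism $\pi_t:C^*(\Lambda,c)\to B$ is injective if and only if $t_v\ne0$ for all $v\in\Lambda^0$.
   Context: $k$-graphs. For a nonnegative integer $k$, a $k$-graph is a nonempty countable small category $\Lambda$ with a functor $d:\Lambda\to\mathbb{N}^k$ (the degree; $0\in\mathbb{N}$) with the factorisation property: whenever $d(\lambda)=m+n$ with $m,n\in\mathbb N^k$ there are unique $\mu,\nu\in\Lambda$ with $d(\mu)=m$, $d(\nu)=n$, $\lambda=\mu\nu$. Write $\Lambda^n=d^{-1}(n)$. The set $\Lambda^0$ is identified with the set of objects (identity morphisms), and $r,s:\Lambda\to\Lambda^0$ are codomain and domain. Put $v\Lambda^n=\{\lambda\in\Lambda^n:r(\lambda)=v\}$; $\Lambda$ is row-finite if every $v\Lambda^n$ is finite, and has no sources if every $v\Lambda^n$ is nonempty. For $z\in\mathbb{T}^k$ and $n\in\mathbb{Z}^k$, $z^n=\prod_iz_i^{n_i}$. Twisted $k$-graph algebras. $\mathbb{T}$ (unit circle) is written multiplicatively. $\Lambda^{*r}$ is the set of composable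 $r$-tuples. $\underline{Z}^2(\Lambda,\mathbb{T})$ is the group of functions $c:\Lambda^{*2}\to\mathbb{T}$ with $c(\lambda_1,\lambda_2)=1$ if $\lambda_1$ or $\lambda_2$ is in $\Lambda^0$, and $c(\lambda_1,\lambda_2)c(\lambda_1\lambda_2,\lambda_3)=c(\lambda_2,\lambda_3)c(\lambda_1,\lambda_2\lambda_3)$ on $\Lambda^{*3}$. A Cuntz--Krieger $(\Lambda,c)$-family in a $C^*$-algebra $B$ is a function $t:\Lambda\to B$ with: (CK1) $\{t_v:v\in\Lambda^0\}$ are mutually orthogonal projections; (CK2) $t_\mu t_\nu=c(\mu,\nu)t_{\mu\nu}$ whenever $s(\mu)=r(\nu)$; (CK3) $t_\lambda^*t_\lambda=t_{s(\lambda)}$; (CK4) $t_v=\sum_{\lambda\in v\Lambda^n}t_\lambda t_\lambda^*$ for all $v\in\Lambda^0,n\in\mathbb{N}^k$. $C^*(\Lambda,c)$ is the universal $C^*$-algebra generated by a Cuntz--Krieger $(\Lambda,c)$-family $\{s_\lambda\}$; for a Cuntz--Krieger $(\Lambda,c)$-family $t$ in $B$, $\pi_t:C^*(\Lambda,c)\to B$ is the homomorphism with $\pi_t(s_\lambda)=t_\lambda$ for all $\lambda$. *)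

(* Defs.v *)
From HB Require Import structures.
From mathcomp Require Import all_boot all_order all_algebra.
From mathcomp Require Import all_classical all_reals all_analysis.
From mathcomp Require Import complex.

Set Implicit Arguments.
Unset Strict Implicit.
Unset Printing Implicit Defensive.

Import Order.TTheory GRing.Theory Num.Theory.
Import numFieldNormedType.Exports.

Local Open Scope classical_set_scope.
Local Open Scope ring_scope.

(* C*-algebras are not assumed unital, so the product is not taken from the
   ring hierarchy.  The norm of a complex normed space is [R[i]]-valued (its
   values are nonnegative reals). *)
HB.mixin Record CompleteNormedModule_isCStarAlgebra (R : realType) A
    of CompleteNormedModule R[i] A := {
  cmul : A -> A -> A;
  cstar : A -> A;
  cmulA : associative cmul;
  cmul_linearl : forall (a : R[i]) (x y z : A),
    cmul (a *: x + y) z = a *: cmul x z + cmul y z;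
  cmul_linearr : forall (a : R[i]) (x y z : A),
    cmul x (a *: y + z) = a *: cmul x y + cmul x z;
  cstarK : involutive cstar;
  cstar_antilinear : forall (a : R[i]) (x y : A),
    cstar (a *: x + y) = Num.conj a *: cstar x + cstar y;
  cstarM : forall x y : A, cstar (cmul x y) = cmul (cstar y) (cstar x);
  cnormM : forall x y : A, `|cmul x y| <= `|x| * `|y|;
  cnorm_cstar : forall x : A, `|cmul (cstar x) x| = `|x| ^+ 2
}.

#[short(type="cstarAlgType")]
HB.structure Definition CStarAlgebra (R : realType) :=
  {A of CompleteNormedModule R[i] A & CompleteNormedModule_isCStarAlgebra R A}.

Declare Scope cstar_scope.
Delimit Scope cstar_scope with cstar.
Notation "x ** y" := (cmul x y) (at level 40, left associativity) : cstar_scope.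
Notation "x ^†" := (cstar x) (at level 2, format "x ^†") : cstar_scope.
Local Open Scope cstar_scope.

Definition star_hom (R : realType) (A B : cstarAlgType R) (f : A -> B) : Prop :=
  [/\ forall (a : R[i]) (x y : A), f (a *: x + y) = a *: f x + f y,
      forall x y : A, f (x ** y) = f x ** f y
    & forall x : A, f (x^†) = (f x)^†].

Definition star_automorphism (R : realType) (A : cstarAlgType R) (f : A -> A) :
  Prop := star_hom f /\ bijective f.

Definition cstar_subalgebra (R : realType) (A : cstarAlgType R) (S : set A) :
    Prop :=
  [/\ S 0,
      forall (a : R[i]) (x y : A), S x -> S y -> S (a *: x + y),
      forall x y : A, S x -> S y -> S (x ** y),
      forall x : A, S x -> S (x^†)
    & closed S].

Definition generates (R : realType) (A : cstarAlgType R) (G : set A) : Prop :=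
  forall S : set A, cstar_subalgebra S -> G `<=` S -> S = setT.

Definition torus (R : realType) (k : nat) : set 'rV[R[i]^o]_k :=
  [set z | forall i, `|z ord0 i| = 1].

Definition torus1 (R : realType) (k : nat) : 'rV[R[i]^o]_k := const_mx 1.

Definition torusM (R : realType) (k : nat) (z w : 'rV[R[i]^o]_k) :
  'rV[R[i]^o]_k := \row_i (z ord0 i * w ord0 i).

Definition torusX (R : realType) (k : nat) (z : 'rV[R[i]^o]_k)
    (n : {ffun 'I_k -> nat}) : R[i] :=
  \prod_(i < k) z ord0 i ^+ n i.

(* Only the restriction of [beta] to the torus is relevant. *)
Definition strongly_continuous_action (R : realType) (k : nat)
    (B : cstarAlgType R) (beta : 'rV[R[i]^o]_k -> B -> B) : Prop :=
  [/\ forall z, @torus R k z -> star_automorphism (beta z),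
      forall b, beta (@torus1 R k) b = b,
      forall z w, @torus R k z -> @torus R k w ->
        forall b, beta (torusM z w) b = beta z (beta w b)
    & forall b, {within @torus R k, continuous (fun z => beta z b)}].

(* [kg_comp mu nu] is the composite "mu after nu"; it is only meaningful, and
   only constrained, when [kg_src mu = kg_rng nu]. *)
Record kgraph (k : nat) := KGraph {
  kg_vertex : countType;
  kg_path :> countType;
  kg_rng : kg_path -> kg_vertex;
  kg_src : kg_path -> kg_vertex;
  kg_id : kg_vertex -> kg_path;
  kg_comp : kg_path -> kg_path -> kg_path;
  kg_deg : kg_path -> {ffun 'I_k -> nat};
  kg_nonempty : inhabited kg_path;
  kg_rng_id : forall v, kg_rng (kg_id v) = v;
  kg_src_id : forall v, kg_src (kg_id v) = v;
  kg_rng_comp : forall mu nu, kg_src mu = kg_rng nu ->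
    kg_rng (kg_comp mu nu) = kg_rng mu;
  kg_src_comp : forall mu nu, kg_src mu = kg_rng nu ->
    kg_src (kg_comp mu nu) = kg_src nu;
  kg_compA : forall la mu nu, kg_src la = kg_rng mu -> kg_src mu = kg_rng nu ->
    kg_comp la (kg_comp mu nu) = kg_comp (kg_comp la mu) nu;
  kg_comp_idl : forall la, kg_comp (kg_id (kg_rng la)) la = la;
  kg_comp_idr : forall la, kg_comp la (kg_id (kg_src la)) = la;
  kg_deg_id : forall v, kg_deg (kg_id v) = 0;
  kg_deg_comp : forall mu nu, kg_src mu = kg_rng nu ->
    kg_deg (kg_comp mu nu) = kg_deg mu + kg_deg nu;
  kg_factorisation : forall la (m n : {ffun 'I_k -> nat}),
    kg_deg la = m + n ->
    exists! p : kg_path * kg_path,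
      [/\ kg_deg p.1 = m, kg_deg p.2 = n, kg_src p.1 = kg_rng p.2
        & la = kg_comp p.1 p.2]
}.

Definition composable (k : nat) (L : kgraph k) (mu nu : L) : Prop :=
  kg_src mu = kg_rng nu.

Definition paths_to (k : nat) (L : kgraph k) (v : kg_vertex L)
    (n : {ffun 'I_k -> nat}) : set L :=
  [set la | kg_rng la = v /\ kg_deg la = n].

Definition row_finite (k : nat) (L : kgraph k) : Prop :=
  forall (v : kg_vertex L) n, finite_set (paths_to v n).

Definition no_sources (k : nat) (L : kgraph k) : Prop :=
  forall (v : kg_vertex L) n, paths_to v n !=set0.

(* Values of [c] at non-composable pairs are irrelevant. *)
Definition cocycle2 (R : realType) (k : nat) (L : kgraph k)
    (c : L -> L -> R[i]) : Prop :=
  [/\ forall mu nu : L, composable mu nu -> `|c mu nu| = 1,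
      forall mu nu : L, composable mu nu ->
        kg_deg mu = 0 \/ kg_deg nu = 0 -> c mu nu = 1
    & forall la mu nu : L, composable la mu -> composable mu nu ->
        c la mu * c (kg_comp la mu) nu = c mu nu * c la (kg_comp mu nu)].

(* The sum in the last clause is the library's sum over a classical set, which
   is the ordinary finite sum when [L] is row-finite. *)
Definition ck_family (R : realType) (k : nat) (L : kgraph k)
    (c : L -> L -> R[i]) (B : cstarAlgType R) (t : L -> B) : Prop :=
  [/\ (forall v : kg_vertex L,
         t (kg_id v) ** t (kg_id v) = t (kg_id v) /\
         (t (kg_id v))^† = t (kg_id v)) /\
      (forall v w : kg_vertex L, v <> w -> t (kg_id v) ** t (kg_id w) = 0),
      forall mu nu : L, composable mu nu ->
        t mu ** t nu = c mu nu *: t (kg_comp mu nu),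
      forall la : L, (t la)^† ** t la = t (kg_id (kg_src la))
    & forall (v : kg_vertex L) n,
        t (kg_id v) = \sum_(la \in paths_to v n) t la ** (t la)^†].

(* [(A, s)] is the universal C*-algebra C*(L, c) with its generating family
   (uniqueness of the induced homomorphism follows from generation). *)
Definition universal_ck_family (R : realType) (k : nat) (L : kgraph k)
    (c : L -> L -> R[i]) (A : cstarAlgType R) (s : L -> A) : Prop :=
  [/\ ck_family c s,
      generates (range s)
    & forall (B : cstarAlgType R) (t : L -> B), ck_family c t ->
        exists pi : A -> B, star_hom pi /\ forall la, pi (s la) = t la].

(* Main.v *)
(* Write |x| for the norm.  The elements s_mu s_nu^* with d(mu) = d(nu) = n span
   direct sums of matrix algebras, on which the coefficients of x are bounded by
   |pi_t x| as soon as every t_v is nonzero.  Averaging the gauge action of B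
   over the roots of unity bounds every homogeneous component of pi_t x by
   |pi_t x|.  Hence |x| <= P |pi_t x| for x in the linear span of all s_mu s_nu^*,
   where P is polynomial in the size of the degrees occurring in x.  Applied to
   (x^* x)^(2^j), whose norm is |x|^(2^(j+1)) and whose degrees grow like 2^j,
   this gives |x| <= |pi_t x| in the limit, so pi_t is isometric on a dense
   subalgebra.  No spectral theory is needed: star homomorphisms are bounded
   because a small self-adjoint element is half the sum of two unitaries.

   Conversely, t_v = pi_t s_v is nonzero once s_v is, and for this it is enough
   that some Cuntz-Krieger (L, c)-family does not vanish at v.  Fix an infinite
   path x with range v, cut into segments x_m of degree (1, ..., 1).  The twisted
   left translations e_mu |-> c(la, mu) e_(la mu) commute with the twisted right
   translations e_mu |-> c(mu, x_m) e_(mu x_m), hence act on the direct limit of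
   the spaces l^2(L r(x_m)) along the latter; there they satisfy (CK4) because
   every basis vector is represented by paths of arbitrarily large degree. *)
Require Import Defs.
From HB Require Import structures.
From mathcomp Require Import all_boot all_order all_algebra.
From mathcomp Require Import all_classical all_reals all_analysis.
From mathcomp Require Import complex finmap cyclic separable cyclotomic.
From mathcomp Require Import ring lra zify.
Import Order.TTheory GRing.Theory Num.Theory.
Import numFieldNormedType.Exports.
Local Open Scope classical_set_scope.
Local Open Scope ring_scope.

Set Implicit Arguments.
Unset Strict Implicit.
Unset Printing Implicit Defensive.

Local Open Scope cstar_scope.

(** The axioms provide norms but no order, and this shapes the argument. (CK4) only says that range
    projections sum to a vertex projection; their orthogonality is drawn from the fact that a
    projection is an extreme point of the unit ball of its corner. Star homomorphisms are bounded
    here by the constant 2, which costs nothing: the passage to powers absorbs every factor that is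
    polynomial in the degrees. Roots of unity of order [2 D + 1] make the extraction of a
    homogeneous component a finite sum and still separate the degrees from [-D] to [D].

    For the converse, C*(L, c) is known through its universal property alone, so showing that
    something in it is nonzero takes a concrete family. On l^2(L) left translations violate (CK4) at
    short paths, whereas for an infinite path [x] the phase [c(la, x)] has no meaning. The direct
    limit combines both: its basis vectors behave like infinite paths, and phases are computed on
    finite representatives. Inner products are real parts of the hermitian ones; for complex linear
    operators they determine the same adjoints. *)

(** * Growth of powers against polynomials *)

Lemma ler_pow2_polynomial (R : realType) (x y C : R) (k : nat) : 0 <= x -> 0 <= y ->
  (forall j, x ^+ (2 ^ j)%N <= C * (2 ^+ j) ^+ k * y ^+ (2 ^ j)%N) -> x <= y.
Proof.
move=> x0 y0 H; rewrite leNgt; apply/negP => yx.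
have x_gt0 : 0 < x by exact: le_lt_trans yx.
have [y_eq0|y_neq0] := eqVneq y 0.
  have := H 0%N; rewrite expn0 !expr1 y_eq0 mulr0 => x_le0.
  by rewrite ltNge x_le0 in x_gt0.
have y_gt0 : 0 < y by rewrite lt0r y_neq0.
pose r := x / y.
have r1 : 1 < r by rewrite /r ltr_pdivlMr// mul1r.
have Hr j : r ^+ (2 ^ j)%N <= C * (2 ^+ j) ^+ k.
  by rewrite /r expr_div_n ler_pdivrMr ?exprn_gt0.
pose h := r - 1.
have h0 : 0 < h by rewrite subr_gt0.
have C0 : 0 <= C.
  by have := Hr 0%N; rewrite expr0 expr1n mulr1; apply: le_trans; rewrite exprn_ge0// ltW// (lt_trans ltr01).
have bern n : h * n%:R <= r ^+ n.
  have -> : r = 1 + h by rewrite /h addrC subrK.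
  elim: n => [|n IH]; first by rewrite mulr0 expr0 ler01.
  have : h * 1 <= h * (1 + h) ^+ n.
    by rewrite (ler_wpM2l (ltW h0))// exprn_ege1// lerDl ltW.
  move: IH; rewrite -natr1 mulr1 exprS; set X := (1 + h) ^+ n; lra.
(* Passing from [j] to [j + l] raises [r ^+ (2 ^ j)] to a power at least [k.+1], so Bernoulli gives
   a lower bound of degree [k.+1] in [2 ^+ j] against an upper bound of degree [k]. *)
pose l := k.+1.
have l2 : (k.+1 <= 2 ^ l)%N by rewrite ltnW// ltn_expl.
have key j : h ^+ k.+1 * 2 ^+ j <= C * 2 ^+ (l * k)%N.
  have A1 : (h * 2 ^+ j) ^+ k.+1 <= r ^+ (2 ^ (j + l))%N.
    apply: (@le_trans _ _ ((r ^+ (2 ^ j)%N) ^+ k.+1)).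
      have Hb := bern (2 ^ j)%N; rewrite natrX in Hb.
      by apply: lerXn2r => //; rewrite ?nnegrE ?mulr_ge0 ?exprn_ge0 ?ltW// (lt_trans ltr01).
    by rewrite expnD exprM; apply: ler_weXn2l => //; rewrite exprn_ege1 ?ltW.
  have := le_trans A1 (Hr _).
  rewrite exprD exprMn [h ^+ k.+1 * 2 ^+ j]mulrC exprM.
  move: (2 ^+ l) => b; set a := 2 ^+ j => H1.
  have P0 : 0 < a ^+ k by rewrite exprn_gt0// exprn_gt0.
  rewrite -(ler_pM2l P0).
  have -> : a ^+ k * (a * h ^+ k.+1) = h ^+ k.+1 * a ^+ k.+1 by rewrite (exprS a); ring.
  by rewrite (le_trans H1)// exprMn mulrCA.
pose hk := h ^+ k.+1; pose c := C * 2 ^+ (l * k)%N.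
have hk0 : 0 < hk by rewrite exprn_gt0.
pose N := Num.bound (c / hk).
have : c < hk * 2 ^+ N.
  rewrite mulrC -ltr_pdivrMr//.
  apply: (@lt_le_trans _ _ N%:R).
    by apply: archi_boundP; rewrite divr_ge0 ?(ltW hk0)// mulr_ge0 ?exprn_ge0.
  by rewrite -natrX ler_nat ltnW// ltn_expl.
by rewrite ltNge key.
Qed.

(** * Norms and self-adjoint elements of C*-algebras *)

Section CStarBasics.
Variables (R : realType) (A : cstarAlgType R).
Implicit Types (x y z : A) (a b : R[i]).

Lemma cmulDl x y z : (x + y) ** z = x ** z + y ** z.
Proof. by have := cmul_linearl 1 x y z; rewrite !scale1r. Qed.
Lemma cmulDr x y z : x ** (y + z) = x ** y + x ** z.
Proof. by have := cmul_linearr 1 x y z; rewrite !scale1r. Qed.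
Lemma cmul0l x : 0 ** x = 0.
Proof. by apply: (@addIr _ (0 ** x)); rewrite -cmulDl !add0r. Qed.
Lemma cmul0r x : x ** 0 = 0.
Proof. by apply: (@addIr _ (x ** 0)); rewrite -cmulDr !add0r. Qed.
Lemma cmulZl a x y : (a *: x) ** y = a *: (x ** y).
Proof. by have := cmul_linearl a x 0 y; rewrite cmul0l !addr0. Qed.
Lemma cmulZr a x y : x ** (a *: y) = a *: (x ** y).
Proof. by have := cmul_linearr a x y 0; rewrite cmul0r !addr0. Qed.
Lemma cmulNl x y : (- x) ** y = - (x ** y).
Proof. by rewrite -scaleN1r cmulZl scaleN1r. Qed.
Lemma cmulNr x y : x ** (- y) = - (x ** y).
Proof. by rewrite -scaleN1r cmulZr scaleN1r. Qed.
Lemma cmulBl x y z : (x - y) ** z = x ** z - y ** z.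
Proof. by rewrite cmulDl cmulNl. Qed.
Lemma cmulBr x y z : x ** (y - z) = x ** y - x ** z.
Proof. by rewrite cmulDr cmulNr. Qed.
Lemma cmul_suml (I : Type) (r : seq I) (P : pred I) (F : I -> A) x :
  (\sum_(i <- r | P i) F i) ** x = \sum_(i <- r | P i) F i ** x.
Proof. by apply: (big_morph (fun y => y ** x)) => [y z|]; rewrite ?cmulDl ?cmul0l. Qed.
Lemma cmul_sumr (I : Type) (r : seq I) (P : pred I) (F : I -> A) x :
  x ** (\sum_(i <- r | P i) F i) = \sum_(i <- r | P i) x ** F i.
Proof. by apply: (big_morph (fun y => x ** y)) => [y z|]; rewrite ?cmulDr ?cmul0r. Qed.

Lemma cstarD x y : (x + y)^† = x^† + y^†.
Proof. by have := cstar_antilinear 1 x y; rewrite rmorph1 !scale1r. Qed.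
Lemma cstar0 : (0 : A)^† = 0.
Proof. by apply: (@addIr _ ((0 : A)^†)); rewrite -cstarD !add0r. Qed.
Lemma cstarZ a x : (a *: x)^† = Num.conj a *: x^†.
Proof. by have := cstar_antilinear a x 0; rewrite cstar0 !addr0. Qed.
Lemma cstarN x : (- x)^† = - x^†.
Proof. by rewrite -scaleN1r cstarZ rmorphN rmorph1 scaleN1r. Qed.
Lemma cstarB x y : (x - y)^† = x^† - y^†.
Proof. by rewrite cstarD cstarN. Qed.
Lemma cstar_sum (I : Type) (r : seq I) (P : pred I) (F : I -> A) :
  (\sum_(i <- r | P i) F i)^† = \sum_(i <- r | P i) (F i)^†.
Proof. by apply: (big_morph (fun y => y^†)) => [y z|]; rewrite ?cstarD ?cstar0. Qed.

(** Brings the norm into [R], where real arithmetic and its decision procedures apply. *)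
Definition cnrm x : R := complex.Re `|x|.

Lemma cnrmE x : `|x| = (cnrm x)%:C%C.
Proof. by rewrite /cnrm RRe_real// ger0_real. Qed.
Lemma cnrm_ge0 x : 0 <= cnrm x.
Proof. by rewrite -ler0c -cnrmE. Qed.
Lemma cnrmD x y : cnrm (x + y) <= cnrm x + cnrm y.
Proof. by rewrite -lecR rmorphD/= -!cnrmE ler_normD. Qed.
Lemma cnrmN x : cnrm (- x) = cnrm x.
Proof. by rewrite /cnrm normrN. Qed.
Lemma cnrmB x y : cnrm (x - y) <= cnrm x + cnrm y.
Proof. by rewrite -(cnrmN y) cnrmD. Qed.
Lemma cnrmC x y : cnrm (x - y) = cnrm (y - x).
Proof. by rewrite -cnrmN opprB. Qed.
Lemma cnrm0 : cnrm 0 = 0.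
Proof. by rewrite /cnrm normr0. Qed.
Lemma cnrmZ a x : cnrm (a *: x) = complex.Re `|a| * cnrm x.
Proof.
apply: (@complexI R); by rewrite rmorphM/= -!cnrmE normrZ.
Qed.
Lemma cnrmZ1 a x : `|a| = 1 -> cnrm (a *: x) = cnrm x.
Proof. by move=> a1; rewrite cnrmZ a1 mul1r. Qed.
Lemma cnrmZn (n : nat) x : cnrm (n%:R *: x) = n%:R * cnrm x.
Proof. by rewrite cnrmZ normr_nat -(rmorph_nat (real_complex R)). Qed.
Lemma cnrmM x y : cnrm (x ** y) <= cnrm x * cnrm y.
Proof. by rewrite -lecR rmorphM/= -!cnrmE cnormM. Qed.
Lemma cnrm_cstarM x : cnrm (x^† ** x) = cnrm x ^+ 2.
Proof. by apply: (@complexI R); rewrite rmorphXn/= -!cnrmE cnorm_cstar. Qed.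
Lemma cnrm_eq0 x : cnrm x = 0 -> x = 0.
Proof. by move=> x0; apply/normr0_eq0; rewrite cnrmE x0. Qed.
Lemma cnrm_le0 x : cnrm x <= 0 -> x = 0.
Proof. by move=> x0; apply: cnrm_eq0; apply/eqP; rewrite eq_le x0 cnrm_ge0. Qed.
Lemma cnrm_sum (I : Type) (r : seq I) (P : pred I) (F : I -> A) :
  cnrm (\sum_(i <- r | P i) F i) <= \sum_(i <- r | P i) cnrm (F i).
Proof.
elim/big_ind2 : _ => // [|x1 x2 y1 y2 H1 H2]; first by rewrite cnrm0.
exact: le_trans (cnrmD _ _) (lerD H1 H2).
Qed.
Lemma cnrm_star x : cnrm x^† = cnrm x.
Proof.
have H y : cnrm y <= cnrm y^†.
  have [y0|y0] := eqVneq (cnrm y) 0; first by rewrite y0 cnrm_ge0.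
  have : cnrm y ^+ 2 <= cnrm y^† * cnrm y by rewrite -cnrm_cstarM cnrmM.
  by rewrite expr2 ler_pM2r// lt0r y0 cnrm_ge0.
by apply/eqP; rewrite eq_le H andbT -{2}(cstarK x) H.
Qed.
Lemma cstarM_eq0 x : x^† ** x = 0 -> x = 0.
Proof.
by move=> x0; apply: cnrm_eq0; apply/eqP; rewrite -sqrf_eq0 -cnrm_cstarM x0 cnrm0.
Qed.

Lemma cnrm_split x y z : cnrm (x - z) <= cnrm (x - y) + cnrm (y - z).
Proof. by rewrite -[x - z](subrKA y) cnrmD. Qed.

Lemma geometric_eq0 (C : R) x : (forall n, cnrm x <= C * 2^-1 ^+ n) -> x = 0.
Proof.
move=> H; apply: cnrm_le0; rewrite leNgt; apply/negP => x0.
have C0 : 0 < C by have := H 0%N; rewrite expr0 mulr1; apply: lt_le_trans.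
pose N := Num.bound (C / cnrm x).
have : C / cnrm x < 2 ^+ N.
  apply: (@lt_le_trans _ _ N%:R).
    by apply: archi_boundP; rewrite divr_ge0 ?ltW.
  by rewrite -natrX ler_nat ltnW// ltn_expl.
rewrite ltr_pdivrMr// mulrC -ltr_pdivrMr ?exprn_gt0// ltNge.
by rewrite -exprVn H.
Qed.

Lemma geometric_cvg (u : nat -> A) (C : R) :
  (forall n, cnrm (u n.+1 - u n) <= C * 2^-1 ^+ n) ->
  exists l, forall n, cnrm (u n - l) <= 2 * C * 2^-1 ^+ n.
Proof.
move=> H.
have C0 : 0 <= C by have := H 0%N; rewrite expr0 mulr1; apply: le_trans; exact: cnrm_ge0.
(* The factor [1 - 2^-1 ^+ m] is what makes the induction on [m] close; [tail'] drops it. *)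
have tail n m : cnrm (u (n + m)%N - u n) <= 2 * C * 2^-1 ^+ n * (1 - 2^-1 ^+ m).
  elim: m => [|m IH]; first by rewrite addn0 subrr cnrm0 expr0 subrr mulr0.
  rewrite addnS; apply: le_trans (cnrm_split _ (u (n + m)%N) _) _.
  apply: le_trans (lerD (H _) IH) _.
  by rewrite exprD exprS le_eqVlt; apply/orP; left; apply/eqP; field.
have tail' n m : cnrm (u (n + m)%N - u n) <= 2 * C * 2^-1 ^+ n.
  apply: le_trans (tail n m) _; rewrite ler_piMr//.
    by rewrite !mulr_ge0 ?exprn_ge0// invr_ge0.
have smallE (e : R) : 0 < e -> exists n, 2 * C * 2^-1 ^+ n < e.
  move=> e0; pose N := Num.bound (2 * C / e); exists N.
  have : 2 * C / e < 2 ^+ N.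
    apply: (@lt_le_trans _ _ N%:R).
      by apply: archi_boundP; rewrite divr_ge0 ?mulr_ge0// ltW.
    by rewrite -natrX ler_nat ltnW// ltn_expl.
  by rewrite exprVn ltr_pdivrMr// => H1; rewrite ltr_pdivrMr ?exprn_gt0// [e * _]mulrC.
have : cvg (u @ \oo).
  apply/cauchy_cvgP; apply/cauchyP => e e_gt0.
  have er : e = (complex.Re e)%:C%C by rewrite RRe_real// gtr0_real.
  have [|n Hn] := smallE (complex.Re e); first by rewrite -ltcR -er.
  exists (u n); exists n => // m /= nm.
  rewrite -ball_normE/= /ball_ /= cnrmE er ltcR cnrmC -(subnKC nm).
  exact: le_lt_trans (tail' n _) Hn.
move=> /cvg_ex[l ul]; exists l => n.
apply/ler_addgt0Pr => e e0.
have eC : (0 : R[i]) < e%:C%C by rewrite ltcR.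
move/cvgrPdist_lt: ul => /(_ _ eC)[m _ Hm].
have := Hm (n + m)%N (leq_addl _ _); rewrite /= cnrmE ltcR => h1.
apply: le_trans (cnrm_split _ (u (n + m)%N) _) _.
rewrite [cnrm (u n - _)]cnrmC [cnrm (_ - l)]cnrmC.
have := tail' n m; move: h1; lra.
Qed.

(* For commuting self-adjoint [p], [y] the hypothesis says [p^2 + (1 - y)^2 = 1]
   in the unitization, so that [p + i (1 - y)] and [p - i (1 - y)] are unitary
   and [p] is half their sum. *)
Lemma cnrm_circle_le1 p y : p^† = p -> y^† = y -> p ** y = y ** p ->
  p ** p + y ** y = y + y -> cnrm p <= 1.
Proof.
move=> pS yS py circ.
(* The unitary [p + e (1 - y)], with [e] equal to ['i] or [- 'i], exists only in the unitization;
   what is used is its action on elements [b] of [A], which is isometric. *)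
have iso (e : R[i]) (b : A) : Num.conj e = - e -> e * e = -1 ->
    cnrm (e *: (b - y ** b) + p ** b) = cnrm b.
  move=> eS ee; apply/eqP; rewrite -(@eqrXn2 _ 2) ?cnrm_ge0// -!cnrm_cstarM; apply/eqP; congr cnrm.
  rewrite cstarD cstarZ cstarB !cstarM pS yS eS.
  rewrite cmulDl 2!cmulDr !cmulZl !cmulZr scalerA mulNr ee opprK scale1r.
  have -> : b^† ** p ** (b - y ** b) = (b^† - b^† ** y) ** (p ** b).
    by rewrite cmulBl cmulBr -!cmulA !(cmulA p) !(cmulA y) py.
  rewrite addrA -[X in X + _]addrA scaleNr addNr addr0.
  have -> : b^† ** p ** (p ** b) = b^† ** (y ** b) + b^† ** (y ** b) - b^† ** (y ** (y ** b)).
    by rewrite -cmulA (cmulA p) -[p ** p](addrK (y ** y)) circ cmulBl cmulDl cmulBr cmulDr -!cmulA.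
  rewrite cmulBl !cmulBr -!cmulA.
  set t1 := b^† ** b; set t2 := b^† ** (y ** b); set t3 := b^† ** _.
  by rewrite opprB !addrA addrNK (addrAC _ t3) addrNK addrK.
have ei : Num.conj 'i = - 'i :> R[i] by rewrite conjCi.
have ii : 'i * 'i = -1 :> R[i] by rewrite -expr2 sqrCi.
have le (b : A) : cnrm (p ** b) <= cnrm b.
  have i1 := iso 'i b ei ii.
  have i2 := iso (- 'i) b; rewrite rmorphN /= ei mulrNN ii in i2.
  have := cnrmD ('i *: (b - y ** b) + p ** b) (- 'i *: (b - y ** b) + p ** b).
  rewrite i1 i2// addrACA -scalerDl subrr scale0r add0r.
  rewrite -mulr2n -scaler_nat cnrmZn; lra.
have := le p; rewrite -{1}pS cnrm_cstarM; have := cnrm_ge0 p; nra.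
Qed.

(* [1 - sqrt (1 - x^2)], the limit of the iteration [y := (x^2 + y^2) / 2]. *)
Lemma circle_solution x : x^† = x -> cnrm x <= 2^-1 ->
  exists y, [/\ y^† = y, x ** y = y ** x & x ** x + y ** y = y + y].
Proof.
move=> xS x2.
pose f y := 2^-1 *: (x ** x + y ** y).
pose u n := iter n f 0.
have half : complex.Re `|2^-1 : R[i]| = 2^-1.
  by rewrite normfV normr_nat -[2%:R](rmorph_nat (real_complex R)) -fmorphV.
(* The ball of radius 1/2 is stable under [f]. On it [a^2 - b^2 = a (a - b) + (a - b) b] has norm at
   most [|a - b|], so the factor 1/2 in [f] halves the increments. *)
have u2 n : cnrm (u n) <= 2^-1.
  elim: n => [|n IH]; first by rewrite cnrm0 invr_ge0.
  rewrite /= cnrmZ half; have := cnrmD (x ** x) (u n ** u n).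
  have := cnrmM x x; have := cnrmM (u n) (u n).
  have := cnrm_ge0 (u n); have := cnrm_ge0 x; rewrite -/(u n); nra.
have uS n : (u n)^† = u n.
  elim: n => [|n IH]; first exact: cstar0.
  by rewrite /= cstarZ cstarD !cstarM -/(u n) IH xS fmorphV rmorph_nat.
have ux n : x ** u n = u n ** x.
  elim: n => [|n IH]; first by rewrite cmul0l cmul0r.
  rewrite /= cmulZl cmulZr cmulDl cmulDr cmulA -/(u n); congr (_ *: (_ + _)).
  by rewrite cmulA IH -!cmulA IH.
have uu n : cnrm (u n.+1 - u n) <= 2^-1 ^+ n.
  elim: n => [|n IH].
    by rewrite expr0 subr0 (le_trans (u2 _))// invf_le1// ler1n.
  have -> : u n.+2 - u n.+1 =
      2^-1 *: (u n.+1 ** (u n.+1 - u n) + (u n.+1 - u n) ** u n).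
    rewrite cmulBl cmulBr addrA subrK [u n.+2]/= -/(u n.+1).
    by rewrite [in X in _ - X]/= -/(u n) -scalerBr opprD addrACA subrr add0r.
  rewrite cnrmZ half exprS ler_wpM2l ?invr_ge0//.
  apply: le_trans (cnrmD _ _) _.
  apply: le_trans (lerD (cnrmM _ _) (cnrmM _ _)) _.
  have := u2 n; have := u2 n.+1; have := cnrm_ge0 (u n.+1 - u n).
  move: IH; nra.
have [|y uy] := @geometric_cvg u 1; first by move=> n; rewrite mul1r.
have yS : y^† = y.
  apply/eqP; rewrite -subr_eq0; apply/eqP; apply: (@geometric_eq0 4) => n.
  apply: le_trans (cnrm_split _ (u n) _) _.
  rewrite cnrmC -{1}(uS n) -cstarB cnrm_star.
  have := uy n; lra.
have xy : x ** y = y ** x.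
  apply/eqP; rewrite -subr_eq0; apply/eqP; apply: (@geometric_eq0 2) => n.
  apply: le_trans (cnrm_split _ (u n ** x) _) _.
  rewrite -{1}ux -cmulBl -cmulBr.
  apply: le_trans (lerD (cnrmM _ _) (cnrmM _ _)) _.
  rewrite [cnrm (y - _)]cnrmC; have := uy n.
  have : cnrm x * cnrm (u n - y) <= 2^-1 * cnrm (u n - y) by rewrite ler_wpM2r ?cnrm_ge0.
  lra.
exists y; split => //.
apply/eqP; rewrite -subr_eq0; apply/eqP; apply: (@geometric_eq0 8) => n.
have y2 : cnrm y <= 5 / 2.
  have := uy 0%N; rewrite expr0 sub0r cnrmN; lra.
(* Comparison with the exact relation [x ** x + u n ** u n = 2 *: u n.+1]. *)
have -> : x ** x + y ** y - (y + y) =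
    ((y - u n) ** y + u n ** (y - u n)) + (2 *: (u n.+1 - y)).
  rewrite cmulBl cmulBr addrA subrK scalerBr /= scalerA mulfV ?pnatr_eq0// scale1r.
  by rewrite -/(u n) scaler_nat mulr2n addrA addrACA addNr addr0 [y ** y + _]addrC.
apply: le_trans (cnrmD _ _) _.
apply: le_trans (lerD (cnrmD _ _) (lexx _)) _.
apply: le_trans (lerD (lerD (cnrmM _ _) (cnrmM _ _)) (lexx _)) _.
rewrite cnrmZn [cnrm (y - _)]cnrmC.
have := uy n; have := uy n.+1; rewrite exprS; have := cnrm_ge0 (u n - y).
have := u2 n; have := cnrm_ge0 y; nra.
Qed.

End CStarBasics.

(** * Star homomorphisms and the power trick *)

Section StarHom.
Variables (R : realType) (A B : cstarAlgType R) (f : A -> B).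
Hypothesis f_hom : star_hom f.

Lemma star_homD x y : f (x + y) = f x + f y.
Proof. by case: f_hom => H _ _; have := H 1 x y; rewrite !scale1r. Qed.
Lemma star_hom0 : f 0 = 0.
Proof. by apply: (@addIr _ (f 0)); rewrite -star_homD !add0r. Qed.
Lemma star_homZ a x : f (a *: x) = a *: f x.
Proof. by case: f_hom => H _ _; have := H a x 0; rewrite star_hom0 !addr0. Qed.
Lemma star_homB x y : f (x - y) = f x - f y.
Proof. by rewrite star_homD -scaleN1r star_homZ scaleN1r. Qed.
Lemma star_homM x y : f (x ** y) = f x ** f y.
Proof. by case: f_hom. Qed.
Lemma star_homS x : f (x^†) = (f x)^†.
Proof. by case: f_hom. Qed.
Lemma star_hom_sum (I : Type) (r : seq I) (P : pred I) (F : I -> A) :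
  f (\sum_(i <- r | P i) F i) = \sum_(i <- r | P i) f (F i).
Proof. by apply: big_morph => [x y|]; [exact: star_homD | exact: star_hom0]. Qed.

(** Rescaled to norm 1/2, [x] has a partner [y] on the circle of [circle_solution]. The circle
    relation is a star polynomial identity, so [f] preserves it and [cnrm_circle_le1] applies in
    [B]; the rescaling accounts for the constant 2. *)
Lemma cnrm_star_hom_sa x : x^† = x -> cnrm (f x) <= 2 * cnrm x.
Proof.
move=> xS; have [x0|x0] := eqVneq (cnrm x) 0.
  by rewrite (cnrm_eq0 x0) star_hom0 !cnrm0 mulr0.
have x_gt0 : 0 < cnrm x by rewrite lt0r x0 cnrm_ge0.
pose c : R[i] := ((2 * cnrm x)^-1)%:C%C.
have nc : complex.Re `|c| = (2 * cnrm x)^-1.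
  by rewrite ger0_norm//= ler0c invr_ge0 mulr_ge0// cnrm_ge0.
have [||y [yS yx y2]] := @circle_solution R A (c *: x).
- by rewrite cstarZ xS; congr (_ *: _); apply/CrealP; rewrite /c complex_real.
- by rewrite cnrmZ nc invfM -mulrA mulVf// mulr1.
have : cnrm (f (c *: x)) <= 1.
  apply: (@cnrm_circle_le1 _ _ _ (f y)).
  - by rewrite -star_homS cstarZ xS; congr (f (_ *: _)); apply/CrealP; rewrite /c complex_real.
  - by rewrite -star_homS yS.
  - by rewrite -!star_homM yx.
  - by rewrite -!star_homM -!star_homD y2.
by rewrite star_homZ cnrmZ nc mulrC ler_pdivrMr ?mulr_gt0// mul1r.
Qed.

Lemma cnrm_star_hom x : cnrm (f x) <= 2 * cnrm x.
Proof.
have : cnrm (f x) ^+ 2 <= 2 * cnrm x ^+ 2.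
  rewrite -!cnrm_cstarM -star_homS -star_homM; apply: cnrm_star_hom_sa.
  by rewrite cstarM cstarK.
by have := cnrm_ge0 x; have := cnrm_ge0 (f x); nra.
Qed.

End StarHom.

Section PowerTrick.
Variables (R : realType) (A B : cstarAlgType R) (f : A -> B).
Hypothesis f_hom : star_hom f.

Definition star_squares (x : A) j := iter j (fun y => y ** y) (x^† ** x).

Lemma star_squares_sa x j : (star_squares x j)^† = star_squares x j.
Proof.
elim: j => [|j IH]; first by rewrite cstarM cstarK.
by rewrite /= cstarM -/(star_squares x j) IH.
Qed.

Lemma cnrm_star_squares x j : cnrm (star_squares x j) = (cnrm x ^+ 2) ^+ (2 ^ j)%N.
Proof.
elim: j => [|j IH]; first by rewrite expr1 -cnrm_cstarM.
rewrite /= -/(star_squares x j) -{1}(star_squares_sa x j) cnrm_cstarM IH.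
by rewrite expnS mulnC -exprM.
Qed.

End PowerTrick.

Lemma star_hom_squares (R : realType) (A B : cstarAlgType R) (f : A -> B)
    (f_hom : star_hom f) x j : f (star_squares x j) = star_squares (f x) j.
Proof.
elim: j => [|j IH]; first by rewrite star_homM// star_homS.
by rewrite /= star_homM// -/(star_squares x j) IH.
Qed.

(** The norms of the [star_squares] are exact powers of [cnrm x ^+ 2], so a loss that is polynomial
    in [2 ^+ j] disappears on taking roots. A fixed loss is the case [k = 0]. *)
Lemma cnrm_le_power_trick (R : realType) (A B : cstarAlgType R) (f : A -> B)
    (f_hom : star_hom f) (x : A) (C : R) (k : nat) :
  (forall j, cnrm (star_squares x j) <= C * (2 ^+ j) ^+ k * cnrm (f (star_squares x j))) ->
  cnrm x <= cnrm (f x).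
Proof.
move=> H; rewrite -(@ler_pXn2r _ 2) ?nnegrE ?cnrm_ge0//.
apply: (@ler_pow2_polynomial _ _ _ C k); rewrite ?exprn_ge0 ?cnrm_ge0// => j.
by have := H j; rewrite star_hom_squares// !cnrm_star_squares.
Qed.

(** * Projections that sum to a projection *)

Section Projections.
Variables (R : realType) (A : cstarAlgType R).
Implicit Types (e h p x y : A).

(* The four contractions [e + z h], [z] in [{w, -w, iw, -iw}], square and average
   to the same four with [w] replaced by [(1 + i) w]; iterating forces [h = 0]. *)
Lemma projection_extreme e h : e ** e = e -> e^† = e -> e ** h = h -> h ** e = h ->
  h^† = h -> cnrm (e + h) <= 1 -> cnrm (e - h) <= 1 -> h = 0.
Proof.
move=> ee eS eh he hS hp hm.
have sq (z : R[i]) : (e + z *: h) ** (e + z *: h) = e + (2 * z) *: h + (z * z) *: (h ** h).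
  rewrite cmulDl !cmulDr !cmulZl !cmulZr ee eh he scalerA.
  by rewrite addrA -(addrA e) -scalerDl; congr (_ + _ *: _ + _); ring.
have sq_le x : cnrm x <= 1 -> cnrm (x ** x) <= 1.
  by move=> x1; apply: le_trans (cnrmM _ _) _; have := cnrm_ge0 x; nra.
have avg x y z : x + y = 2%:R *: z -> cnrm x <= 1 -> cnrm y <= 1 -> cnrm z <= 1.
  move=> xyz x1 y1; have := cnrmD x y; rewrite xyz cnrmZn; lra.
(* For [z] equal to ['i] or [- 'i] this is the square of the norm of [e + z h], which starts the
   induction at the two imaginary points. *)
have hh : cnrm (e + h ** h) <= 1.
  apply: (avg ((e + 1 *: h) ** (e + 1 *: h)) ((e + (-1) *: h) ** (e + (-1) *: h))).
  - rewrite !sq mulrNN !mulr1 !scale1r mulrN1 scaleNr addrACA.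
    by rewrite [e + _ + _]addrACA subrr addr0 scaler_nat mulrnDl !mulr2n.
  - by apply: sq_le; rewrite scale1r.
  - by apply: sq_le; rewrite scaleN1r.
pose N4 (z : R[i]) := cnrm (e + z *: h) <= 1.
have ii : 'i * 'i = -1 :> R[i] by rewrite -expr2 sqrCi.
have Ni (z : R[i]) : Num.conj z = - z -> z * z = -1 -> N4 z.
  move=> zS zz; rewrite /N4 -(@ler_pXn2r _ 2) ?nnegrE ?cnrm_ge0// expr1n -cnrm_cstarM.
  rewrite cstarD cstarZ eS hS zS cmulDl !cmulDr !cmulZl !cmulZr ee eh he scalerA.
  by rewrite mulNr zz opprK scale1r addrA -[e + _ + _]addrA scaleNr subrr addr0.
pose z0 : R[i] := 1 + 'i.
have step (z : R[i]) : N4 z -> N4 ('i * z) -> N4 (z0 * z).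
  move=> Nz Niz; apply: (avg ((e + z *: h) ** (e + z *: h)) ((e + ('i * z) *: h) ** (e + ('i * z) *: h))).
  - rewrite !sq addrACA -scalerDl; have -> : z * z + 'i * z * ('i * z) = 0.
      by rewrite mulrACA ii mulN1r subrr.
    rewrite scale0r addr0 addrACA -scalerDl -mulrDr scalerDr scalerA.
    congr (_ + _); last by rewrite /z0 [(1 + 'i) * z]mulrDl mul1r.
    by rewrite scaler_nat.
  - exact: sq_le.
  - exact: sq_le.
have N4n n : [/\ N4 (z0 ^+ n), N4 ('i * z0 ^+ n), N4 (- z0 ^+ n) & N4 (- ('i * z0 ^+ n))].
  elim: n => [|n [H1 H2 H3 H4]].
    rewrite expr0 mulr1; split; rewrite /N4 ?scale1r ?scaleN1r//.
    - by apply: Ni => //; exact: conjCi.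
    - by apply: Ni; rewrite ?mulrNN// rmorphN /= conjCi.
  rewrite exprS; move: (z0 ^+ n) H1 H2 H3 H4 => w H1 H2 H3 H4; split.
  - exact: (step w H1 H2).
  - rewrite mulrCA; apply: (step ('i * w) H2); rewrite mulrA ii mulN1r; exact: H3.
  - rewrite -mulrN; apply: (step (- w) H3); rewrite mulrN; exact: H4.
  - rewrite mulrCA -mulrN; apply: (step (- ('i * w)) H4).
    rewrite mulrN mulrA ii mulN1r opprK; exact: H1.
have nz0 : complex.Re `|z0| ^+ 2 = 2.
  have : `|z0| ^+ 2 = 2%:R.
    rewrite normCK rmorphD/= rmorph1 conjCi mulrDl mul1r mulrBr mulr1 ii opprK; ring.
  have -> : `|z0| = (complex.Re `|z0|)%:C%C by rewrite RRe_real// ger0_real.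
  by rewrite -rmorphXn/= -(rmorph_nat (real_complex R)) => /complexI.
have e1 : cnrm e <= 1.
  have := cnrm_cstarM e; rewrite eS ee; have := cnrm_ge0 e; nra.
have hn n : (complex.Re `|z0|) ^+ n * cnrm h <= 2.
  have [H _ _ _] := N4n n; have := cnrmB (e + z0 ^+ n *: h) e.
  rewrite addrC addKr cnrmZ normrX.
  have -> : complex.Re (`|z0| ^+ n) = complex.Re `|z0| ^+ n.
    apply: (@complexI R); rewrite rmorphXn RRe_real ?ger0_real ?exprn_ge0//.
  by move: H; rewrite /N4; lra.
apply: (@geometric_eq0 _ _ 2) => n; have := hn (2 * n)%N.
by rewrite exprM nz0 exprVn ler_pdivlMr ?exprn_gt0// mulrC.
Qed.

Definition projection p := p ** p = p /\ p^† = p.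

Lemma cnrm_projection_le1 p : projection p -> cnrm p <= 1.
Proof. by case=> pp pS; have := cnrm_cstarM p; rewrite pS pp; have := cnrm_ge0 p; nra. Qed.

Lemma cnrm_projection p : projection p -> p <> 0 -> cnrm p = 1.
Proof.
case=> pp pS p0; have := cnrm_cstarM p; rewrite pS pp.
have : cnrm p != 0 by apply/eqP => /cnrm_eq0.
by move=> H; rewrite expr2 -{1}(mulr1 (cnrm p)) => /(mulfI H).
Qed.

(** [1 - 2 p] is a symmetry, so [x - p ** x] is the mean of two elements with the norm of [x]. *)
Lemma cnrm_compl_projection p x : projection p -> cnrm (x - p ** x) <= cnrm x.
Proof.
case=> pp pS.
have H : cnrm (x - 2%:R *: (p ** x)) = cnrm x.
  apply/eqP; rewrite -(@eqrXn2 _ 2) ?cnrm_ge0// -!cnrm_cstarM; apply/eqP; congr cnrm.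
  rewrite cstarB cstarZ rmorph_nat cstarM pS cmulBl !cmulBr !cmulZl !cmulZr.
  rewrite -!cmulA (cmulA p p) pp; set s := 2%:R *: (x^† ** _).
  by rewrite [2%:R *: s]scaler_nat [s *+ 2]mulr2n opprB addrK subrK.
have := cnrmD x (x - 2%:R *: (p ** x)); rewrite H addrA -mulr2n -scaler_nat -scalerBr cnrmZn; lra.
Qed.

(** Compressing [p = \sum q l] by [e = q j] and cancelling the term [e] leaves a vanishing sum of
    the elements [w l = e ** q l ** e] with [l] different from [j]. Each [e - w l] is of the form
    [z^† ** z] with [z] a contraction. Hence a small multiple of [w i] can be both added to and
    subtracted from [e] within the unit ball, and extremality of [e] gives [w i = 0], that is,
    [q i ** e = 0]. *)
Lemma sum_projections_orthogonal (I : eqType) (r : seq I) (q : I -> A) (p : A) :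
  uniq r -> (forall i, i \in r -> projection (q i)) ->
  (forall i, i \in r -> p ** q i = q i) ->
  p = \sum_(i <- r) q i ->
  forall i j, i \in r -> j \in r -> i != j -> q i ** q j = 0.
Proof.
move=> r_uniq qP pq ps i j ir jr ij.
have [] := qP _ jr; have := pq _ jr; set e := q j => pe ejj ejS.
pose w l := e ** q l ** e.
pose F := rem j r.
have FE l : l \in F -> l \in r /\ l != j.
  by rewrite /F rem_filter// mem_filter => /andP[].
have sF : \sum_(l <- F) w l = 0.
  have : e + \sum_(l <- F) w l = e + 0.
    rewrite addr0.
    have : e ** p ** e = e by rewrite -cmulA pe.
    rewrite ps cmul_sumr cmul_suml (perm_big _ (perm_to_rem jr))/= big_cons -/e ejj ejj.
    by [].
  by move=> /addrI.
have iF : i \in F by rewrite /F rem_filter// mem_filter/= ij.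
pose G := rem i F.
have wi : w i = - \sum_(l <- G) w l.
  apply/eqP; rewrite -addr_eq0; apply/eqP.
  by move: sF; rewrite (perm_big _ (perm_to_rem iF))/= big_cons.
have e1 : cnrm e <= 1 by apply: cnrm_projection_le1; apply: qP.
have ew l : l \in r -> cnrm (e - w l) <= 1.
  move=> lr; have [qq qS] := qP _ lr.
  have -> : e - w l = (e - q l ** e)^† ** (e - q l ** e).
    rewrite cstarB cstarM ejS qS cmulBl !cmulBr ejj /w.
    by rewrite -!cmulA (cmulA (q l) (q l)) qq opprB addrA subrK.
  rewrite cnrm_cstarM expr_le1//; last exact: cnrm_ge0.
  by apply: le_trans e1; apply: cnrm_compl_projection.
(* With this [N], both [e + w i / N] and [e - w i / N] are means of [N] elements taken among [e] and
   the [e - w l]: for the first, [w i] is replaced by minus the sum over [G]. *)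
pose N := (size G).+1.
have h0 : N%:R^-1 *: w i = 0.
  have N0 : N%:R != 0 :> R[i] by rewrite pnatr_eq0.
  have Ninv : complex.Re `|(N%:R^-1 : R[i])| = N%:R^-1.
    by rewrite normfV normr_nat -(rmorph_nat (real_complex R)) -fmorphV.
  have wS : (w i)^† = w i.
    by rewrite /w !cstarM ejS; have [_ ->] := qP _ ir; rewrite cmulA.
  have scale x : cnrm (N%:R *: e + x) <= N%:R -> cnrm (e + N%:R^-1 *: x) <= 1.
    have -> : e + N%:R^-1 *: x = N%:R^-1 *: (N%:R *: e + x).
      by rewrite scalerDr scalerA mulVf// scale1r.
    by rewrite cnrmZ Ninv ler_pdivrMl ?ltr0n// mulr1.
  apply: (@projection_extreme e) => //.
  - by rewrite cmulZr /w !cmulA ejj.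
  - by rewrite cmulZl /w -!cmulA ejj.
  - by rewrite cstarZ wS fmorphV rmorph_nat.
  - apply: scale; rewrite wi.
    have -> : N%:R *: e - \sum_(l <- G) w l = e + \sum_(l <- G) (e - w l).
      by rewrite sumrB addrA big_const_seq count_predT iter_addr_0 scaler_nat mulrS.
    apply: le_trans (cnrmD _ _) _.
    apply: le_trans (lerD (lexx _) (cnrm_sum _ _ _)) _.
    rewrite /N -natr1 addrC; apply: lerD => //.
    have -> : (size G)%:R = \sum_(l <- G) (1 : R).
      by rewrite big_const_seq count_predT iter_addr_0.
    rewrite big_seq [leRHS]big_seq; apply: ler_sum => l lG; apply: ew.
    by have [] := FE l (mem_rem lG).
  - rewrite -scalerN; apply: scale.
    have -> : N%:R *: e - w i = (size G)%:R *: e + (e - w i).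
      by rewrite addrA !scaler_nat /N -mulrSr.
    apply: le_trans (cnrmD _ _) _; rewrite cnrmZn /N -natr1; apply: lerD; last exact: ew.
    by rewrite ler_piMr.
have w0 : w i = 0.
  by move/eqP: h0; rewrite scaler_eq0 invr_eq0 pnatr_eq0/= => /eqP.
apply: cstarM_eq0; rewrite cstarM ejS; have [qq ->] := qP _ ir.
by rewrite -cmulA (cmulA (q i)) qq cmulA.
Qed.

End Projections.

(** * Cuntz-Krieger families and their cores *)

Section CKFamily.
Variables (R : realType) (k : nat) (L : kgraph k) (c : L -> L -> R[i]).
Hypothesis L_row_finite : row_finite L.
Hypothesis c_cocycle : cocycle2 c.
Variables (B : cstarAlgType R) (t : L -> B).
Hypothesis t_family : ck_family c t.
Implicit Types (mu nu la : L) (m n l : {ffun 'I_k -> nat}).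

Lemma ck_vertex_projection v : projection (t (kg_id v)).
Proof. by case: t_family => -[H _] _ _ _; exact: H. Qed.

Lemma ck_comp mu nu : kg_src mu = kg_rng nu ->
  t mu ** t nu = c mu nu *: t (kg_comp mu nu).
Proof. by case: t_family => _ H _ _; exact: H. Qed.

Lemma ck_starM la : (t la)^† ** t la = t (kg_id (kg_src la)).
Proof. by case: t_family. Qed.

Lemma ck_rng la : t (kg_id (kg_rng la)) ** t la = t la.
Proof.
rewrite ck_comp ?kg_src_id// kg_comp_idl.
case: c_cocycle => _ H _; rewrite H ?scale1r//; first exact: kg_src_id.
by left; rewrite kg_deg_id.
Qed.

Lemma ck_src la : t la ** t (kg_id (kg_src la)) = t la.
Proof.
rewrite ck_comp ?kg_rng_id// kg_comp_idr.
case: c_cocycle => _ H _; rewrite H ?scale1r//; first by rewrite /composable kg_rng_id.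
by right; rewrite kg_deg_id.
Qed.

Lemma ck_src_star la : t (kg_id (kg_src la)) ** (t la)^† = (t la)^†.
Proof.
by have [_ {1}<-] := ck_vertex_projection (kg_src la); rewrite -cstarM ck_src.
Qed.

Lemma ck_range_projection la : projection (t la ** (t la)^†).
Proof.
split; last by rewrite cstarM cstarK.
by rewrite cmulA -(cmulA (t la)) ck_starM ck_src.
Qed.

Lemma cnrm_ck_le1 la : cnrm (t la) <= 1.
Proof.
have := cnrm_projection_le1 (ck_vertex_projection (kg_src la)).
by rewrite -ck_starM cnrm_cstarM; have := cnrm_ge0 (t la); nra.
Qed.

Lemma ck_sum v n :
  t (kg_id v) = \sum_(la <- fset_set (paths_to v n)) t la ** (t la)^†.
Proof.
case: t_family => _ _ _ /(_ v n) ->; rewrite fsbig_finite//; exact: L_row_finite.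
Qed.

Lemma mem_paths_to v n la :
  (la \in fset_set (paths_to v n)) = (kg_rng la == v) && (kg_deg la == n).
Proof.
rewrite in_fset_set; last exact: L_row_finite.
by apply/idP/andP => [/set_mem[-> ->]|[/eqP H1 /eqP H2]]; [|apply/mem_set].
Qed.

(** When the ranges agree, (CK4) presents the range projections of all paths of that range and
    degree as summing to a vertex projection, which forces them to be orthogonal. *)
Lemma ck_orthogonal mu nu : kg_deg mu = kg_deg nu -> mu != nu ->
  (t mu)^† ** t nu = 0.
Proof.
move=> dmn mn; have [rmn|rmn] := eqVneq (kg_rng mu) (kg_rng nu); last first.
  have [_ vS] := ck_vertex_projection (kg_rng mu).
  have H : t (kg_id (kg_rng mu)) ** t (kg_id (kg_rng nu)) = 0.
    by case: t_family => -[_ H] _ _ _; apply: H; exact/eqP.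
  rewrite -(ck_rng mu) -(ck_rng nu) cstarM vS -cmulA.
  by rewrite [t (kg_id (kg_rng mu)) ** _]cmulA H cmul0l cmul0r.
have H : (t mu ** (t mu)^†) ** (t nu ** (t nu)^†) = 0.
  apply: (@sum_projections_orthogonal _ _ _ (fset_set (paths_to (kg_rng mu) (kg_deg mu)))
    (fun la => t la ** (t la)^†) (t (kg_id (kg_rng mu)))) => //.
  - by move=> i _; exact: ck_range_projection.
  - by move=> i; rewrite mem_paths_to => /andP[/eqP <- _]; rewrite cmulA ck_rng.
  - exact: ck_sum.
  - by rewrite mem_paths_to !eqxx.
  - by rewrite mem_paths_to dmn rmn !eqxx.
have : (t mu)^† ** ((t mu ** (t mu)^†) ** (t nu ** (t nu)^†)) ** t nu = 0.
  by rewrite H cmul0r cmul0l.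
rewrite !cmulA ck_starM ck_src_star -!cmulA ck_starM ck_src; exact.
Qed.

Lemma ck_starM_eq mu nu : kg_deg mu = kg_deg nu ->
  (t mu)^† ** t nu = if mu == nu then t (kg_id (kg_src nu)) else 0.
Proof. by move=> d; case: eqVneq => [->|/(ck_orthogonal d)//]; exact: ck_starM. Qed.

(** Under a gauge action these elements are homogeneous of degree [m - n]; for [m = n] they form one
    layer of the core. *)
Inductive path_span (m n : {ffun 'I_k -> nat}) : B -> Prop :=
| path_span0 : path_span m n 0
| path_span_add a mu nu x : kg_deg mu = m -> kg_deg nu = n -> kg_src mu = kg_src nu ->
    path_span m n x -> path_span m n (a *: (t mu ** (t nu)^†) + x).

Lemma path_spanD m n x y : path_span m n x -> path_span m n y -> path_span m n (x + y).
Proof.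
elim=> [|a mu nu z dm dn s _ IH] Hy; first by rewrite add0r.
by rewrite -addrA; apply: path_span_add => //; exact: IH.
Qed.

Lemma path_spanZ m n b x : path_span m n x -> path_span m n (b *: x).
Proof.
elim=> [|a mu nu z dm dn s _ IH]; first by rewrite scaler0; exact: path_span0.
by rewrite scalerDr scalerA; exact: path_span_add.
Qed.

Lemma path_span_sum m n (I : eqType) (r : seq I) (F : I -> B) :
  (forall i, i \in r -> path_span m n (F i)) -> path_span m n (\sum_(i <- r) F i).
Proof.
elim: r => [|i r IH] H; first by rewrite big_nil; exact: path_span0.
rewrite big_cons; apply: path_spanD; first by apply: H; rewrite mem_head.
by apply: IH => j jr; apply: H; rewrite inE jr orbT.
Qed.

Lemma path_span_gen mu nu : kg_src mu = kg_src nu ->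
  path_span (kg_deg mu) (kg_deg nu) (t mu ** (t nu)^†).
Proof.
move=> s; rewrite -[_ ** _]addr0 -[X in X + _]scale1r.
by apply: path_span_add => //; exact: path_span0.
Qed.

Lemma path_span_ind_gen m n (P : B -> Prop) : P 0 ->
  (forall x y, P x -> P y -> P (x + y)) -> (forall a x, P x -> P (a *: x)) ->
  (forall mu nu, kg_deg mu = m -> kg_deg nu = n -> kg_src mu = kg_src nu ->
     P (t mu ** (t nu)^†)) ->
  forall x, path_span m n x -> P x.
Proof.
move=> P0 PD PZ Pgen x; elim=> // a mu nu y dm dn s _ Py.
by apply: PD => //; apply: PZ; exact: Pgen.
Qed.

Lemma path_span_star m n x : path_span m n x -> path_span n m x^†.
Proof.
move: x; apply: path_span_ind_gen => [|x y Hx Hy|a x Hx|mu nu <- <- s].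
- by rewrite cstar0; exact: path_span0.
- by rewrite cstarD; exact: path_spanD.
- by rewrite cstarZ; exact: path_spanZ.
- by rewrite cstarM cstarK; exact: path_span_gen.
Qed.

Lemma path_span_mul m n l x y : path_span m n x -> path_span n l y ->
  path_span m l (x ** y).
Proof.
move=> Hx Hy; move: x Hx.
apply: path_span_ind_gen => [|x z Hx Hz|a x Hx|mu nu <- dn s].
- by rewrite cmul0l; exact: path_span0.
- by rewrite cmulDl; exact: path_spanD.
- by rewrite cmulZl; exact: path_spanZ.
move: y Hy; apply: path_span_ind_gen => [|x z Hx Hz|a x Hx|eta ze de <- s'].
- by rewrite cmul0r; exact: path_span0.
- by rewrite cmulDr; exact: path_spanD.
- by rewrite cmulZr; exact: path_spanZ.
rewrite cmulA -(cmulA (t mu)) ck_starM_eq ?dn ?de//.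
case: eqVneq => [ne|_]; last by rewrite cmul0r cmul0l; exact: path_span0.
rewrite -ne -s ck_src; apply: path_span_gen; by rewrite s ne.
Qed.

(** Inserting (CK4) at the common source of [mu] and [nu] lengthens both by the same paths. This is
    how the inner degrees of two factors are made equal, as [path_span_mul] requires. *)
Lemma path_span_shift m n l x : path_span m n x -> path_span (m + l) (n + l) x.
Proof.
move: x; apply: path_span_ind_gen => [|x y Hx Hy|a x Hx|mu nu <- <- s].
- exact: path_span0.
- exact: path_spanD.
- exact: path_spanZ.
rewrite -(ck_src mu) (ck_sum _ l) cmul_sumr cmul_suml.
apply: path_span_sum => la; rewrite mem_paths_to => /andP[/eqP r /eqP <-].
rewrite cmulA -cmulA -cstarM !ck_comp ?r// -?s//.
rewrite cstarZ cmulZl cmulZr; apply: path_spanZ; apply: path_spanZ.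
rewrite -!kg_deg_comp -?s//; apply: path_span_gen.
by rewrite !kg_src_comp -?s.
Qed.

End CKFamily.

Section CoreIsometry.
Variables (R : realType) (k : nat) (L : kgraph k) (c : L -> L -> R[i]).
Hypothesis L_row_finite : row_finite L.
Hypothesis c_cocycle : cocycle2 c.

(** The products [t mu ** (t nu)^†] behave as matrix units, one block for each source; entries of
    [a] between paths with different sources are ignored. *)
Definition path_matrix (B : cstarAlgType R) (t : L -> B) (G : seq L) (a : L -> L -> R[i]) : B :=
  \sum_(mu <- G) \sum_(nu <- G | kg_src mu == kg_src nu) a mu nu *: (t mu ** (t nu)^†).

Definition path_matrix_mul (G : seq L) (a b : L -> L -> R[i]) : L -> L -> R[i] :=
  fun mu ze => \sum_(nu <- G | kg_src mu == kg_src nu) a mu nu * b nu ze.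

Section OneFamily.
Variables (B : cstarAlgType R) (t : L -> B).
Hypothesis t_family : ck_family c t.
Variables (n : {ffun 'I_k -> nat}) (G : seq L).
Hypothesis G_uniq : uniq G.
Hypothesis G_deg : forall la, la \in G -> kg_deg la = n.

Lemma path_matrixM a b : path_matrix t G a ** path_matrix t G b =
  path_matrix t G (path_matrix_mul G a b).
Proof.
rewrite /path_matrix cmul_suml; apply: eq_big_seq => mu muG.
rewrite cmul_suml.
transitivity (\sum_(nu <- G | kg_src mu == kg_src nu)
    \sum_(ze <- G | kg_src mu == kg_src ze) (a mu nu * b nu ze) *: (t mu ** (t ze)^†)).
  rewrite big_seq_cond [RHS]big_seq_cond; apply: eq_bigr => nu /andP[nuG /eqP mn].
  rewrite cmulZl cmul_sumr (bigD1_seq nu)//= [X in _ + X]big1_seq ?addr0 => [|eta /andP[en eG]].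
    rewrite cmul_sumr scaler_sumr mn; apply: eq_bigr => ze _.
    rewrite cmulZr scalerA cmulA -(cmulA (t mu)) (ck_starM t_family).
    by rewrite -mn (ck_src c_cocycle t_family).
  rewrite cmul_sumr big1// => ze _; rewrite cmulZr cmulA -(cmulA (t mu)).
  rewrite (ck_orthogonal L_row_finite c_cocycle t_family) ?cmul0r ?cmul0l ?scaler0//.
    by rewrite !G_deg.
  by rewrite eq_sym.
rewrite exchange_big/=; apply: eq_bigr => ze _.
by rewrite /path_matrix_mul scaler_suml.
Qed.

Lemma path_matrix_star a : (path_matrix t G a)^† =
  path_matrix t G (fun mu nu => Num.conj (a nu mu)).
Proof.
rewrite /path_matrix cstar_sum.
transitivity (\sum_(mu <- G) \sum_(nu <- G | kg_src mu == kg_src nu)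
    (Num.conj (a mu nu) *: (t nu ** (t mu)^†))).
  apply: eq_bigr => mu _; rewrite cstar_sum; apply: eq_bigr => nu _.
  by rewrite cstarZ cstarM cstarK.
rewrite (exchange_big_dep predT)//=; apply: eq_bigr => nu _.
by apply: eq_bigl => mu; rewrite eq_sym.
Qed.

Lemma path_matrix_coef a mu nu : mu \in G -> nu \in G -> kg_src mu = kg_src nu ->
  (t mu)^† ** path_matrix t G a ** t nu = a mu nu *: t (kg_id (kg_src nu)).
Proof.
move=> muG nuG mn; rewrite /path_matrix (bigD1_seq mu)//= cmulDr [X in _ + X]cmul_sumr.
rewrite [X in _ + X]big1_seq ?addr0 => [|eta /andP[en eG]]; last first.
  rewrite cmul_sumr big1// => ze _; rewrite cmulZr cmulA.
  rewrite (ck_orthogonal L_row_finite c_cocycle t_family) ?cmul0l ?scaler0//.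
    by rewrite !G_deg.
  by rewrite eq_sym.
rewrite cmul_sumr cmul_suml big_mkcond/= (bigD1_seq nu)//= mn eqxx.
rewrite [X in _ + X]big1_seq ?addr0 => [|eta /andP[en eG]]; last first.
  case: ifP => // _; rewrite cmulZr cmulZl cmulA -cmulA.
  by rewrite (ck_orthogonal L_row_finite c_cocycle t_family (mu := eta) (nu := nu)) ?cmul0r ?scaler0 ?G_deg.
rewrite cmulZr cmulZl cmulA -cmulA !(ck_starM t_family) mn.
by have [-> _] := ck_vertex_projection t_family (kg_src nu).
Qed.

End OneFamily.

Lemma path_span_matrix (B : cstarAlgType R) (t : L -> B) n (x : B) :
  path_span t n n x ->
  exists G a, [/\ uniq G, forall la, la \in G -> kg_deg la = n & x = path_matrix t G a].
Proof.
(* The claim is strengthened to every duplicate-free list containing [G0], so that in the induction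
   both summands are written over the same list. *)
move=> Hx; suff [G0 [dG0 H]] : exists G0 : seq L, (forall la, la \in G0 -> kg_deg la = n) /\
    forall G, uniq G -> {subset G0 <= G} -> exists a, x = path_matrix t G a.
  have [|a ->] := H (undup G0) (undup_uniq _); first by move=> la; rewrite mem_undup.
  exists (undup G0), a; split=> //; first exact: undup_uniq.
  by move=> la; rewrite mem_undup; exact: dG0.
elim: Hx => [|b mu nu y dm dn s _ [G0 [dG0 IH]]].
  exists [::]; split=> // G _ _; exists (fun _ _ => 0).
  by rewrite /path_matrix big1// => mu _; rewrite big1// => nu _; rewrite scale0r.
exists [:: mu, nu & G0]; split=> [la|G uG sG].
  by rewrite !inE => /orP[/eqP->//|/orP[/eqP->//|/dG0]].
have [|a ->] := IH G uG; first by move=> la laG; apply: sG; rewrite !inE laG !orbT.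
have muG : mu \in G by apply: sG; rewrite !inE eqxx.
have nuG : nu \in G by apply: sG; rewrite !inE eqxx orbT.
exists (fun mu' nu' => (if (mu' == mu) && (nu' == nu) then b else 0) + a mu' nu').
rewrite /path_matrix -[X in X + _](_ : \sum_(mu' <- G) \sum_(nu' <- G | kg_src mu' == kg_src nu')
    (if (mu' == mu) && (nu' == nu) then b else 0) *: (t mu' ** (t nu')^†) = _).
  rewrite -big_split; apply: eq_bigr => mu' _ /=; rewrite -big_split.
  by apply: eq_bigr => nu' _ /=; rewrite scalerDl.
rewrite (bigD1_seq mu)//= [X in _ + X]big1_seq ?addr0 => [|mu' /andP[/negPf-> _]]; last first.
  by rewrite big1// => nu' _; rewrite /= scale0r.
rewrite big_mkcond (bigD1_seq nu)//= s !eqxx/= big1_seq ?addr0//.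
by move=> nu' /andP[/negPf-> _]; rewrite scale0r if_same.
Qed.

Variables (A B : cstarAlgType R) (s : L -> A) (t : L -> B) (f : A -> B).
Hypothesis s_family : ck_family c s.
Hypothesis t_family : ck_family c t.
Hypothesis f_hom : star_hom f.
Hypothesis f_s : forall la, f (s la) = t la.
Hypothesis t_neq0 : forall v, t (kg_id v) <> 0.

Lemma star_hom_path_matrix G a : f (path_matrix s G a) = path_matrix t G a.
Proof.
rewrite star_hom_sum//; apply: eq_bigr => mu _; rewrite star_hom_sum//.
by apply: eq_bigr => nu _; rewrite star_homZ// star_homM// star_homS// !f_s.
Qed.

Lemma star_hom_path_span m n x : path_span s m n x -> path_span t m n (f x).
Proof.
elim=> [|a mu nu y dm dn e _ IH]; first by rewrite star_hom0//; exact: path_span0.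
by rewrite star_homD// star_homZ// star_homM// star_homS// !f_s; exact: path_span_add.
Qed.

(** Compression in [B] exhibits each coefficient times a nonzero vertex projection, which has norm
    1. The constant is crude, but it depends on [G] only and not on the coefficients. *)
Lemma cnrm_path_matrix n G a : uniq G -> (forall la, la \in G -> kg_deg la = n) ->
  cnrm (path_matrix s G a) <= (size G)%:R ^+ 2 * cnrm (path_matrix t G a).
Proof.
move=> G_uniq G_deg; set N := cnrm (path_matrix t G a).
apply: (@le_trans _ _ (\sum_(mu <- G) \sum_(nu <- G) N)); last first.
  by rewrite !big_const_seq !count_predT !iter_addr_0 expr2 -mulrnA -natrM mulr_natl.
apply: le_trans (cnrm_sum _ _ _) _.
rewrite big_seq [leRHS]big_seq; apply: ler_sum => mu muG.
apply: le_trans (cnrm_sum _ _ _) _; rewrite big_mkcond/=.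
rewrite big_seq [leRHS]big_seq; apply: ler_sum => nu nuG.
case: eqP => mn; last exact: cnrm_ge0.
have := cnrmM (s mu) (s nu)^†; rewrite cnrm_star cnrmZ => H1.
have H2 := cnrm_ck_le1 t_family; have H3 := cnrm_ck_le1 s_family.
have : complex.Re `|a mu nu| <= N.
  have := path_matrix_coef t_family G_uniq G_deg a muG nuG mn.
  move=> /(congr1 (@cnrm _ _)); rewrite cnrmZ.
  rewrite (cnrm_projection (ck_vertex_projection t_family _) (@t_neq0 _)) mulr1 => <-.
  apply: le_trans (cnrmM _ _) _.
  have := cnrmM (t mu)^† (path_matrix t G a); rewrite cnrm_star -/N.
  have := H2 mu; have := H2 nu; have := cnrm_ge0 (t mu); have := cnrm_ge0 (t nu).
  have := cnrm_ge0 ((t mu)^† ** path_matrix t G a); have : 0 <= N by exact: cnrm_ge0.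
  move=> h1 h2 h3 h4 h5 h6 h7; apply: le_trans (ler_piMr _ _) _ => //.
  by apply: le_trans h7 _; rewrite ler_piMl.
apply: le_trans; rewrite ler_piMr//; first by rewrite -ler0c RRe_real ?ger0_real.
apply: le_trans H1 _; rewrite -[leRHS]mulr1; apply: ler_pM => //; exact: cnrm_ge0.
Qed.

(** All the [star_squares] of a matrix over [G] are again matrices over [G], so [cnrm_path_matrix]
    bounds them with one constant and the power trick removes it. *)
Lemma cnrm_core n x : path_span s n n x -> cnrm x <= cnrm (f x).
Proof.
move=> /path_span_matrix[G [a [G_uniq G_deg ->]]].
apply: (@cnrm_le_power_trick _ _ _ f f_hom _ ((size G)%:R ^+ 2) 0) => j.
rewrite expr0 mulr1.
have [b ->] : exists b, star_squares (path_matrix s G a) j = path_matrix s G b.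
  elim: j => [|j [b IH]].
    exists (path_matrix_mul G (fun mu nu => Num.conj (a nu mu)) a).
    by rewrite /star_squares/= path_matrix_star// (path_matrixM s_family G_uniq G_deg).
  exists (path_matrix_mul G b b).
  by rewrite /= -/(star_squares _ j) IH (path_matrixM s_family G_uniq G_deg).
by rewrite star_hom_path_matrix; exact: cnrm_path_matrix G_deg.
Qed.

(** [x^† ** x] lies in the core layer of degree [n]. *)
Lemma cnrm_path_span m n x : path_span s m n x -> cnrm x <= cnrm (f x).
Proof.
move=> Hx; rewrite -(@ler_pXn2r _ 2) ?nnegrE ?cnrm_ge0// -!cnrm_cstarM.
rewrite -star_homS// -star_homM//; apply: (@cnrm_core n).
exact (path_span_mul L_row_finite c_cocycle s_family (path_span_star Hx) Hx).
Qed.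

End CoreIsometry.

(** * Gauge actions and homogeneous components *)

Lemma closed_prim_root_exists (F : numClosedFieldType) n : (0 < n)%N ->
  exists z : F, n.-primitive_root z.
Proof.
move=> n_gt0; have [r rE] := closed_field_poly_normal ('X^n - 1 : {poly F}).
rewrite (monicP _) ?monicXnsubC// scale1r in rE.
have szr : size r = n by apply: succn_inj; rewrite -(size_prod_XsubC r id) -rE size_XnsubC.
have /hasP[z _ zP] : has n.-primitive_root r; last by exists z.
apply: has_prim_root => //; rewrite ?szr//.
  by apply/allP => z; rewrite -root_prod_XsubC -rE.
by rewrite -separable_prod_XsubC -rE separable_Xn_sub_1// pnatr_eq0 -lt0n.
Qed.

Lemma prim_root_norm (F : numClosedFieldType) n (z : F) : n.-primitive_root z -> `|z| = 1.
Proof.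
move=> zP; apply/eqP; rewrite -(@pexpr_eq1 _ _ n) ?(prim_order_gt0 zP)//.
by rewrite -normrX (prim_expr_order zP) normr1.
Qed.

(** Orthogonality of the characters of a cyclic group: off the diagonal this is a geometric sum with
    ratio [u], an [n]-th root of unity other than 1. *)
Lemma prim_root_orthogonality (F : numClosedFieldType) n (w : F) (a b : 'I_n) :
  n.-primitive_root w ->
  \sum_(q < n) Num.conj ((w ^+ q) ^+ a) * (w ^+ q) ^+ b = if a == b then n%:R else 0.
Proof.
move=> wP; have w1 := prim_root_norm wP.
pose u := Num.conj (w ^+ a) * w ^+ b.
have uE q : Num.conj ((w ^+ q) ^+ a) * (w ^+ q) ^+ b = u ^+ q.
  by rewrite /u exprMn -rmorphXn -!exprM ![(q * _)%N]mulnC.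
rewrite (eq_bigr (fun q : 'I_n => u ^+ q)) => [|q _]; last exact: uE.
have wa : Num.conj (w ^+ a) * w ^+ a = 1.
  by rewrite mulrC -normCK normrX w1 !expr1n.
case: eqVneq => [ab|ab].
  rewrite /u -ab wa (eq_bigr (fun=> 1)) => [|q _]; last exact: expr1n.
  by rewrite sumr_const card_ord.
have u1 : u - 1 != 0.
  apply: contra ab; rewrite subr_eq0 => /eqP uE1.
  have /eqP : w ^+ b = w ^+ a.
    by rewrite -[LHS]mul1r -wa mulrAC -/u uE1 mul1r.
  rewrite (eq_prim_root_expr wP) !modn_small ?ltn_ord// => /eqP ba.
  by apply/eqP/val_inj.
apply: (mulfI u1); rewrite mulr0 -subrX1 /u exprMn -rmorphXn -!exprM.
by rewrite ![(_ * n)%N]mulnC !exprM (prim_expr_order wP) !expr1n rmorph1 mulr1 subrr.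
Qed.

Section Graded.
Variables (R : realType) (k : nat) (L : kgraph k) (c : L -> L -> R[i]).
Hypothesis L_row_finite : row_finite L.
Hypothesis c_cocycle : cocycle2 c.

Definition cst_deg (D : nat) : {ffun 'I_k -> nat} := [ffun=> D].
(** Exponents from 0 to [2 D] in each coordinate; shifted by [D] they are the degrees from [-D] to
    [D], which roots of unity of order [2 D + 1] separate. *)
Definition box (D : nat) := {ffun 'I_k -> 'I_(D.*2.+1)}.
Definition box_deg D (m : box D) : {ffun 'I_k -> nat} := [ffun i => val (m i)].

Lemma deg_addE (m n : {ffun 'I_k -> nat}) i : (m + n) i = (m i + n i)%N.
Proof. by rewrite ffunE. Qed.
Lemma cst_degE D i : cst_deg D i = D.
Proof. by rewrite ffunE. Qed.
Lemma box_deg_le D (m : box D) i : (box_deg m i <= D.*2)%N.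
Proof. by rewrite ffunE -ltnS; exact: ltn_ord. Qed.
Definition degE := (deg_addE, cst_degE).

Section Family.
Variables (B : cstarAlgType R) (t : L -> B).
Hypothesis t_family : ck_family c t.

(* The summand of index [m] is homogeneous of degree [m - (D, ..., D)]. *)
Definition graded_span (D : nat) (x : B) := exists F : box D -> B,
  (forall m, path_span t (box_deg m) (cst_deg D) (F m)) /\ x = \sum_m F m.

Lemma graded_span0 D : graded_span D 0.
Proof. by exists (fun=> 0); split=> [m|]; [exact: path_span0 | rewrite big1]. Qed.

Lemma graded_spanD D x y : graded_span D x -> graded_span D y -> graded_span D (x + y).
Proof.
move=> [F [FP ->]] [G [GP ->]]; exists (fun m => F m + G m); split=> [m|].
  exact: path_spanD.
by rewrite big_split.
Qed.

Lemma graded_spanZ D a x : graded_span D x -> graded_span D (a *: x).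
Proof.
move=> [F [FP ->]]; exists (fun m => a *: F m); split=> [m|]; first exact: path_spanZ.
by rewrite scaler_sumr.
Qed.

Lemma graded_span_sum D (I : finType) (F : I -> B) :
  (forall i, graded_span D (F i)) -> graded_span D (\sum_i F i).
Proof.
move=> H; elim/big_ind : _ => //; [exact: graded_span0 | exact: graded_spanD].
Qed.

Lemma graded_span_homogeneous D (m : {ffun 'I_k -> nat}) x :
  (forall i, m i <= D.*2)%N -> path_span t m (cst_deg D) x -> graded_span D x.
Proof.
move=> mD Hx; pose m' : box D := [ffun i => inord (m i)].
have mE : box_deg m' = m by apply/ffunP => i; rewrite /m' !ffunE /= inordK// ltnS.
exists (fun l => if l == m' then x else 0); split=> [l|].
  by case: eqP => [->|_]; rewrite ?mE//; exact: path_span0.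
by rewrite -big_mkcond big_pred1_eq.
Qed.

(** The adjoint exchanges the two degrees, so that the second one varies with [m]; shifting by
    [2 D - m] makes it constant again, equal to [2 D]. *)
Lemma graded_span_star D x : graded_span D x -> graded_span D.*2 (x^†).
Proof.
move=> [F [FP ->]]; rewrite cstar_sum; apply: graded_span_sum => m.
pose l : {ffun 'I_k -> nat} := [ffun i => (D.*2 - box_deg m i)%N].
apply: (@graded_span_homogeneous _ (cst_deg D + l)).
  by move=> i; rewrite !degE [l i]ffunE; lia.
have -> : cst_deg D.*2 = box_deg m + l.
  by apply/ffunP => i; rewrite !degE [l i]ffunE; have := box_deg_le m i; lia.
exact/(path_span_shift L_row_finite c_cocycle t_family)/path_span_star.
Qed.

(** Shifting the left factor by [m'] and the right one by [D] gives both the inner degree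
    [D + m']. *)
Lemma graded_span_mul D D' x y : graded_span D x -> graded_span D' y ->
  graded_span (D + D') (x ** y).
Proof.
move=> [F [FP ->]] [G [GP ->]]; rewrite cmul_suml; apply: graded_span_sum => m.
rewrite cmul_sumr; apply: graded_span_sum => m'.
apply: (@graded_span_homogeneous _ (box_deg m + box_deg m')).
  move=> i; rewrite !degE; have := box_deg_le m i; have := box_deg_le m' i. lia.
have -> : cst_deg (D + D') = cst_deg D' + cst_deg D by apply/ffunP => i; rewrite !degE; lia.
apply: (path_span_mul L_row_finite c_cocycle t_family (n := cst_deg D + box_deg m')).
  exact: (path_span_shift L_row_finite c_cocycle t_family).
by rewrite addrC; apply: (path_span_shift L_row_finite c_cocycle t_family).
Qed.

Lemma graded_span_mono D D' x : (D <= D')%N -> graded_span D x -> graded_span D' x.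
Proof.
move=> DD [F [FP ->]]; apply: graded_span_sum => m.
apply: (@graded_span_homogeneous _ (box_deg m + cst_deg (D' - D))).
  by move=> i; rewrite !degE; have := box_deg_le m i; lia.
have -> : cst_deg D' = cst_deg D + cst_deg (D' - D) by apply/ffunP => i; rewrite !degE; lia.
exact: (path_span_shift L_row_finite c_cocycle t_family).
Qed.

Lemma graded_span_path la : exists D, graded_span D (t la).
Proof.
pose D := \max_i kg_deg la i.
exists D; apply: (@graded_span_homogeneous _ (kg_deg la + cst_deg D)).
  move=> i; rewrite !degE -addnn leq_add2r.
  exact: (leq_bigmax_cond (F := fun i => kg_deg la i)).
have [_ vS] := ck_vertex_projection t_family (kg_src la).
have sE : kg_src la = kg_src (kg_id (kg_src la)) by rewrite kg_src_id.
have := path_span_shift L_row_finite c_cocycle t_family (cst_deg D) (path_span_gen t sE).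
by rewrite vS (ck_src c_cocycle t_family) kg_deg_id add0r.
Qed.

(** In [x^† ** x] the adjoint contributes [2 D] and [x] contributes [D]; each squaring then doubles
    the index. The growth is thus linear in [2 ^ j], as the power trick demands. *)
Lemma graded_span_squares D x j : graded_span D x ->
  graded_span (3 * D * 2 ^ j)%N (star_squares x j).
Proof.
move=> Hx; elim: j => [|j IH].
  have -> : (3 * D * 2 ^ 0 = D.*2 + D)%N by lia.
  by apply: graded_span_mul => //; exact: graded_span_star.
have -> : (3 * D * 2 ^ j.+1 = 3 * D * 2 ^ j + 3 * D * 2 ^ j)%N by rewrite expnS; lia.
exact: graded_span_mul.
Qed.

Variable beta : 'rV[R[i]^o]_k -> B -> B.
Hypothesis beta_hom : forall z, torus z -> star_hom (beta z).
Hypothesis beta_t : forall z la, torus z -> beta z (t la) = torusX z (kg_deg la) *: t la.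

Lemma gauge_path_span z m n x : torus z -> path_span t m n x ->
  beta z x = (torusX z m * Num.conj (torusX z n)) *: x.
Proof.
move=> zT; move: x; apply: path_span_ind_gen => [|x y Hx Hy|a x Hx|mu nu <- <- s].
- by rewrite (star_hom0 (beta_hom zT)) scaler0.
- by rewrite (star_homD (beta_hom zT)) Hx Hy scalerDr.
- by rewrite (star_homZ (beta_hom zT)) Hx !scalerA mulrC.
rewrite (star_homM (beta_hom zT)) (star_homS (beta_hom zT)) !beta_t//.
by rewrite cstarZ cmulZl cmulZr scalerA.
Qed.

Lemma torusX_norm (z : 'rV[R[i]^o]_k) n : torus z -> `|torusX z n| = 1.
Proof.
by move=> zT; rewrite /torusX normr_prod big1// => i _; rewrite normrX zT expr1n.
Qed.

(** A discrete Fourier coefficient of the gauge action is an average of elements of norm at most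
    [2 * cnrm x], the 2 coming from [cnrm_star_hom]. The bound does not depend on [D]. *)
Lemma cnrm_homogeneous_le D (F : box D -> B) :
  (forall m, path_span t (box_deg m) (cst_deg D) (F m)) ->
  forall m, cnrm (F m) <= 2 * cnrm (\sum_m F m).
Proof.
move=> FP m0; set x := \sum_m F m.
have [w wP] := @closed_prim_root_exists R[i] D.*2.+1 isT.
pose zp (p : box D) : 'rV[R[i]^o]_k := \row_i (w ^+ p i).
have zT p : torus (zp p).
  by move=> i; rewrite mxE normrX (prim_root_norm wP) expr1n.
(* The conjugate of the character by which [beta (zp p)] acts on the component [m0], of degree
   [m0 - D]. *)
pose h (p : box D) := Num.conj (torusX (zp p) (box_deg m0)) * torusX (zp p) (cst_deg D).
have h1 p : `|h p| = 1 by rewrite normrM norm_conjC !torusX_norm// mulr1.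
pose Nb := #|{: box D}|.
have key : \sum_p h p *: beta (zp p) x = Nb%:R *: F m0.
  transitivity (\sum_m (\sum_p Num.conj (torusX (zp p) (box_deg m0)) * torusX (zp p) (box_deg m)) *: F m).
    under [RHS]eq_bigr do rewrite scaler_suml.
    rewrite [RHS]exchange_big/=; apply: eq_bigr => p _.
    rewrite /x (star_hom_sum (beta_hom (zT p))) scaler_sumr; apply: eq_bigr => m _.
    rewrite (gauge_path_span (zT p) (FP m)) scalerA /h mulrACA.
    by rewrite -normCK torusX_norm// expr1n mulr1.
  have ortho m : \sum_p Num.conj (torusX (zp p) (box_deg m0)) * torusX (zp p) (box_deg m) =
      if m == m0 then Nb%:R else 0.
    transitivity (\sum_(p : box D) \prod_i
        (Num.conj ((w ^+ p i) ^+ m0 i) * (w ^+ p i) ^+ m i)).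
      apply: eq_bigr => p _; rewrite /torusX rmorph_prod -big_split/=.
      by apply: eq_bigr => i _; rewrite !mxE !ffunE.
    (* The sum over the whole grid factors into [k] character sums in one variable. *)
    rewrite -(bigA_distr_bigA (fun i (q : 'I_(D.*2.+1)) =>
      Num.conj ((w ^+ q) ^+ m0 i) * (w ^+ q) ^+ m i)) /=.
    under eq_bigr do rewrite prim_root_orthogonality//.
    case: eqVneq => [->|mm].
      under eq_bigr do rewrite eqxx.
      by rewrite prodr_const /Nb card_ffun !card_ord natrX.
    have [i mi|H] := pickP (fun i => m0 i != m i).
      by rewrite (bigD1 i)//= (negPf mi) mul0r.
    by case/eqP: mm; apply/ffunP => i; have /negbFE/eqP := H i.
  under eq_bigr do rewrite ortho.
  by rewrite (bigD1 m0)//= eqxx big1 ?addr0// => m /negPf->; rewrite scale0r.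
have N0 : 0 < Nb%:R :> R.
  by rewrite ltr0n; apply/card_gt0P; exists m0.
have := congr1 (@cnrm _ _) key; rewrite cnrmZn => kE.
rewrite -(ler_pM2l N0) -kE.
apply: le_trans (cnrm_sum _ _ _) _.
apply: (@le_trans _ _ (\sum_(p : box D) 2 * cnrm x)).
  apply: ler_sum => p _; rewrite cnrmZ1//.
  exact: cnrm_star_hom (beta_hom (zT p)) _.
by rewrite sumr_const [leRHS]mulr_natl; exact: lexx.
Qed.

End Family.

Variables (A B : cstarAlgType R) (s : L -> A) (t : L -> B) (f : A -> B).
Hypothesis s_family : ck_family c s.
Hypothesis t_family : ck_family c t.
Hypothesis f_hom : star_hom f.
Hypothesis f_s : forall la, f (s la) = t la.
Hypothesis t_neq0 : forall v, t (kg_id v) <> 0.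
Variable beta : 'rV[R[i]^o]_k -> B -> B.
Hypothesis beta_hom : forall z, torus z -> star_hom (beta z).
Hypothesis beta_t : forall z la, torus z -> beta z (t la) = torusX z (kg_deg la) *: t la.

Lemma cnrm_graded_polynomial D x : graded_span s D x ->
  cnrm x <= 2 * (D.*2.+1)%:R ^+ k * cnrm (f x).
Proof.
move=> [F [FP ->]]; rewrite star_hom_sum//.
apply: le_trans (cnrm_sum _ _ _) _.
apply: (@le_trans _ _ (\sum_(m : box D) 2 * cnrm (\sum_m f (F m)))); last first.
  by rewrite sumr_const card_ffun !card_ord -[leLHS]mulr_natl natrX mulrA [_ ^+ k * 2]mulrC.
apply: ler_sum => m _.
apply: le_trans (cnrm_path_span L_row_finite c_cocycle s_family t_family f_hom f_s t_neq0 (FP m)) _.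
apply: (cnrm_homogeneous_le beta_hom beta_t (F := fun m => f (F m))) => l.
exact: star_hom_path_span.
Qed.

Lemma cnrm_graded D x : graded_span s D x -> cnrm x <= cnrm (f x).
Proof.
(* The index [3 D 2^j] gives [6 D 2^j + 1] degrees per coordinate, at most [(6 D + 1) 2^j]. *)
move=> Hx; pose C : R := 2 * (6 * D + 1)%:R ^+ k.
apply: (@cnrm_le_power_trick _ _ _ f f_hom _ C k) => j.
apply: le_trans (cnrm_graded_polynomial (graded_span_squares s_family j Hx)) _.
rewrite ler_wpM2r ?cnrm_ge0// /C -!mulrA ler_wpM2l// -exprMn.
apply: lerXn2r; rewrite ?nnegrE ?mulr_ge0 ?exprn_ge0//.
rewrite -natrX -natrM ler_nat.
have : (0 < 2 ^ j)%N by rewrite expn_gt0.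
by move: (2 ^ j)%N => q; nia.
Qed.

(** * Density of the graded elements *)

Hypothesis s_generates : generates (range s).

(** [D] may depend on [e]: products and adjoints raise the index, so it is the union over all [D]
    that is a star subalgebra. *)
Definition graded_closure := [set x : A | forall e : R, 0 < e ->
  exists D y, graded_span s D y /\ cnrm (x - y) < e].

Lemma graded_closureP x : (forall e : R, 0 < e -> exists2 y, graded_closure y & cnrm (x - y) < e) ->
  graded_closure x.
Proof.
move=> H e e0; have e2 : 0 < e / 2 by rewrite divr_gt0.
have [y Sy xy] := H _ e2; have [D [z [Dz yz]]] := Sy _ e2.
exists D, z; split=> //; have := cnrm_split x y z; lra.
Qed.

Lemma graded_closure_lin (a : R[i]) x y : graded_closure x -> graded_closure y ->
  graded_closure (a *: x + y).
Proof.
move=> Sx Sy e e0; pose r := complex.Re `|a|.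
have r0 : 0 <= r by rewrite -ler0c RRe_real ?ger0_real.
have [|D [x' [Dx xx]]] := Sx (e / 2 / (r + 1)); first by rewrite !divr_gt0// ltr_wpDl.
have [|D' [y' [Dy yy]]] := Sy (e / 2); first by rewrite divr_gt0.
exists (maxn D D'), (a *: x' + y'); split.
  apply: graded_spanD; first apply: graded_spanZ.
  - exact: (graded_span_mono s_family (leq_maxl _ _) Dx).
  - exact: (graded_span_mono s_family (leq_maxr _ _) Dy).
rewrite opprD addrACA -scalerBr.
have := cnrmD (a *: (x - x')) (y - y'); rewrite cnrmZ -/r.
move: xx; rewrite ltr_pdivlMr ?ltr_wpDl// => xx.
have := cnrm_ge0 (x - x'); move: xx yy; nra.
Qed.

Lemma graded_closureM x y : graded_closure x -> graded_closure y ->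
  graded_closure (x ** y).
Proof.
move=> Sx Sy e e0; have := cnrm_ge0 x; have := cnrm_ge0 y => y0 x0.
(* The bound 1 keeps [cnrm y'] below [cnrm y + 1], so that the precision asked of [x'] can be stated
   in terms of [y]. *)
have [|D' [y' [Dy]]] := Sy (Num.min 1 (e / 2 / (cnrm x + 1))).
  by rewrite lt_min ltr01/= !divr_gt0// ltr_wpDl.
rewrite lt_min => /andP[y1]; rewrite ltr_pdivlMr ?ltr_wpDl// => yy.
have [|D [x' [Dx]]] := Sx (e / 2 / (cnrm y + 1)); first by rewrite !divr_gt0// ltr_wpDl.
rewrite ltr_pdivlMr ?ltr_wpDl// => xx.
exists (D + D')%N, (x' ** y'); split; first exact: graded_span_mul.
apply: le_lt_trans (cnrm_split _ (x ** y') _) _; rewrite -cmulBr -cmulBl.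
have := cnrmM x (y - y'); have := cnrmM (x - x') y'.
have y'y : cnrm y' <= cnrm y + 1.
  have := cnrm_split y' y 0; rewrite !subr0 cnrmC; lra.
have := cnrm_ge0 (x - x'); have := cnrm_ge0 (y - y'); have := cnrm_ge0 y'.
move=> h1 h2 h3 h4 h5.
have h6 : cnrm (x - x') * cnrm y' <= cnrm (x - x') * (cnrm y + 1) by rewrite ler_wpM2l.
have h7 : cnrm x * cnrm (y - y') <= cnrm (y - y') * (cnrm x + 1).
  by rewrite mulrC ler_wpM2l// lerDl.
lra.
Qed.

Lemma graded_closure_full : graded_closure = setT.
Proof.
apply: s_generates => [|_ [la _ <-] e e0]; last first.
  have [D HD] := graded_span_path s_family la.
  by exists D, (s la); rewrite subrr cnrm0.
split.
- by move=> e e0; exists 0%N, 0; rewrite subrr cnrm0; split=> //; exact: graded_span0.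
- exact: graded_closure_lin.
- exact: graded_closureM.
- move=> x Sx e e0; have [D [y [Dy xy]]] := Sx e e0.
  exists D.*2, (y^†); split; first exact: graded_span_star.
  by rewrite -cstarB cnrm_star.
- move=> x clx; apply: graded_closureP => e e0.
  have [|y [Sy xy]] := clx (ball x e%:C%C).
    by apply: nbhsx_ballx; rewrite ltcR.
  exists y => //; move: xy; rewrite -ball_normE/= /ball_/= cnrmE ltcR; exact.
Qed.

Lemma cnrm_isometry x : cnrm x <= cnrm (f x).
Proof.
have : graded_closure x by rewrite graded_closure_full.
move=> Sx; apply/ler_addgt0Pr => e e0.
(* One third is spent between [x] and [y], two thirds between [f y] and [f x], since [cnrm_star_hom]
   loses a factor 2. *)
have [|D [y [Dy xy]]] := Sx (e / 3); first by rewrite divr_gt0.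
have := cnrm_graded Dy; have := cnrm_star_hom f_hom (y - x); rewrite star_homB// (cnrmC y x).
have := cnrm_split x y 0; have := cnrm_split (f y) (f x) 0; rewrite !subr0; lra.
Qed.

Lemma gauge_invariant_injective : injective f.
Proof.
move=> x y fxy; apply/eqP; rewrite -subr_eq0; apply/eqP; apply: cnrm_le0.
by apply: le_trans (cnrm_isometry _) _; rewrite star_homB// fxy subrr cnrm0.
Qed.

End Graded.

(** * Bounded operators on square-summable families *)

Section ComplexDot.
Variable R : realType.
Implicit Types (a b e : R[i]).

(** The real part of [a] times the conjugate of [b]. It keeps sums, limits and inequalities in [R],
    and complex scalars still move across it with a conjugation ([cdotZ]). *)
Definition cdot a b : R := complex.Re a * complex.Re b + complex.Im a * complex.Im b.

Lemma cdotC a b : cdot a b = cdot b a.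
Proof. by rewrite /cdot; ring. Qed.
Lemma cdotDl a b e : cdot (a + b) e = cdot a e + cdot b e.
Proof. by case: a b e => [? ?] [? ?] [? ?]; rewrite /cdot/=; ring. Qed.
Lemma cdotZ e a b : cdot (e * a) b = cdot a (Num.conj e * b).
Proof. by case: a b e => [? ?] [? ?] [? ?]; rewrite /cdot/=; ring. Qed.
Lemma cdotZZ e a b : cdot (e * a) (e * b) = cdot e e * cdot a b.
Proof. by case: a b e => [? ?] [? ?] [? ?]; rewrite /cdot/=; ring. Qed.
Lemma cdotRr (r : R) a b : cdot a (r%:C%C * b) = r * cdot a b.
Proof. by case: a b => [? ?] [? ?]; rewrite /cdot/=; ring. Qed.
Lemma cdot_ge0 a : 0 <= cdot a a.
Proof. by rewrite /cdot addr_ge0// -expr2 sqr_ge0. Qed.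
Lemma cdot_norm a : `|a| ^+ 2 = (cdot a a)%:C%C.
Proof. by rewrite -add_Re2_Im2 /cdot -!expr2. Qed.
Lemma cdot_norm1 a : `|a| = 1 -> cdot a a = 1.
Proof. by move=> a1; apply: (@complexI R); rewrite -cdot_norm a1 expr1n. Qed.
Lemma cdot_eq0 a : cdot a a = 0 -> a = 0.
Proof.
move=> a0; apply/eqP; rewrite -normr_eq0 -sqrf_eq0 cdot_norm a0.
by rewrite rmorph0.
Qed.

End ComplexDot.

Section SquareSummable.
Variables (R : realType) (X : choiceType).
Implicit Types (u v w : X -> R[i]) (s : seq X).

Definition dot_on u v s : R := \sum_(x <- s) cdot (u x) (v x).

Definition square_summable u := exists M : R, forall s, uniq s -> dot_on u u s <= M.

(** Unordered summation: duplicate-free lists stand for finite subsets, directed by inclusion. *)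
Definition finite_subsets : set_system (seq X) :=
  filter_from [set s | uniq s] (fun s0 => [set s | uniq s /\ {subset s0 <= s}]).

#[global] Instance finite_subsets_proper : ProperFilter finite_subsets.
Proof.
apply: filter_from_proper; last by move=> s us; exists s; split.
apply: filter_from_filter; first by exists [::].
move=> s s' us us'; exists (undup (s ++ s')); first exact: undup_uniq.
move=> r /= [ur sr]; split; split=> // x xs; apply: sr; rewrite mem_undup mem_cat xs//.
by rewrite orbT.
Qed.

Lemma dot_on_mono u s s' : uniq s -> uniq s' -> {subset s <= s'} ->
  dot_on u u s <= dot_on u u s'.
Proof.
move=> us us' ss; rewrite /dot_on [leRHS](bigID (mem s))/=.
have -> : \sum_(x <- s' | x \in s) cdot (u x) (u x) = \sum_(x <- s) cdot (u x) (u x).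
  rewrite -big_filter; apply: perm_big; apply: uniq_perm => //.
    exact: filter_uniq.
  by move=> x; rewrite mem_filter; case: (boolP (x \in s)) => // /ss ->.
by rewrite lerDl sumr_ge0// => x _; exact: cdot_ge0.
Qed.

Lemma dot_on_cvg_diag u : square_summable u -> cvg (dot_on u u @ finite_subsets).
Proof.
move=> [M HM]; pose S := [set dot_on u u s | s in [set s | uniq s]].
have supS : has_sup S.
  split; first by exists (dot_on u u [::]), [::].
  by exists M => _ [s us <-]; exact: HM.
apply/cvg_ex; exists (sup S); apply/cvgrPdist_le => e e0.
have [_ [s us <-] He] := sup_adherent e0 supS.
exists s => //= s' [us' ss'].
have H1 := dot_on_mono u us us' ss'.
have H2 : dot_on u u s' <= sup S by apply: ub_le_sup; [case: supS | exists s'].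
by rewrite ger0_norm ?subr_ge0//; lra.
Qed.

Lemma square_summableD u v : square_summable u -> square_summable v ->
  square_summable (u \+ v).
Proof.
move=> [M HM] [M' HM']; exists (2 * M + 2 * M') => s us.
apply: (@le_trans _ _ (2 * dot_on u u s + 2 * dot_on v v s)); last first.
  by have := HM s us; have := HM' s us; lra.
rewrite /dot_on !mulr_sumr -big_split; apply: ler_sum => x _ /=.
have := cdot_ge0 (u x - v x); case: (u x) (v x) => [a b] [a' b'].
by rewrite /cdot/=; lra.
Qed.

Lemma square_summableZ (a : R[i]) u : square_summable u ->
  square_summable (fun x => a * u x).
Proof.
move=> [M HM]; exists (cdot a a * M) => s us.
rewrite /dot_on; under eq_bigr do rewrite cdotZZ.
by rewrite -mulr_sumr ler_wpM2l ?cdot_ge0//; exact: HM.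
Qed.

Lemma square_summable0 : square_summable (fun=> 0).
Proof.
by exists 0 => s _; rewrite /dot_on big1// => x _; rewrite /cdot !mul0r addr0.
Qed.

(** Polarization reduces the convergence to two diagonal sums, which are monotone and bounded. *)
Lemma dot_on_cvg u v : square_summable u -> square_summable v ->
  cvg (dot_on u v @ finite_subsets).
Proof.
move=> Hu Hv; pose p := u \+ v; pose m x := u x + (-1) * v x.
have cp : cvg (dot_on p p @ finite_subsets).
  by apply: dot_on_cvg_diag; exact: square_summableD.
have cm : cvg (dot_on m m @ finite_subsets).
  by apply: dot_on_cvg_diag; apply: square_summableD => //; exact: square_summableZ.
have -> : dot_on u v = (fun s => 4^-1 * (dot_on p p s - dot_on m m s)).
  apply/funext => s; rewrite /dot_on -sumrB mulr_sumr; apply: eq_bigr => x _.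
  rewrite /p /m /=; case: (u x) (v x) => [a b] [a' b']; rewrite /cdot/=.
  by field.
move/cvg_ex: cp => [lp cp]; move/cvg_ex: cm => [lm cm].
by apply/cvg_ex; exists (4^-1 * (lp - lm)); apply: cvgMl_tmp; exact: cvgB.
Qed.

Definition inner u v : R := lim (dot_on u v @ finite_subsets).

Lemma innerP u v : square_summable u -> square_summable v ->
  dot_on u v @ finite_subsets --> inner u v.
Proof. by move=> Hu Hv; exact: dot_on_cvg. Qed.

Lemma inner_eq u v u' v' : (forall x, cdot (u x) (v x) = cdot (u' x) (v' x)) ->
  inner u v = inner u' v'.
Proof.
move=> H; rewrite /inner (_ : dot_on u v = dot_on u' v')//; apply/funext => s.
by apply: eq_bigr => x _; exact: H.
Qed.

Lemma dot_on_le_inner u s : square_summable u -> uniq s -> dot_on u u s <= inner u u.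
Proof.
move=> Hu us; apply: (cvgr_to_ge (innerP Hu Hu)); exists s => //= s' [us' ss'].
exact: dot_on_mono.
Qed.

Lemma inner_le u M : (forall s, uniq s -> dot_on u u s <= M) -> inner u u <= M.
Proof.
move=> H; have Hu : square_summable u by exists M.
by apply: (cvgr_to_le (innerP Hu Hu)); exists [::] => //= s' [us' _]; exact: H.
Qed.

End SquareSummable.

Section Ell2.
Variables (R : realType) (X : choiceType).

Definition square_summable_pred : {pred X -> R[i]} := fun u => `[< square_summable u >].

Lemma square_summable_submod : GRing.submod_closed square_summable_pred.
Proof.
split=> [|a u v]; first by apply/asboolP; exact: square_summable0.
move=> /asboolP Hu /asboolP Hv; apply/asboolP.
by apply: square_summableD => //; exact: square_summableZ.
Qed.

HB.instance Definition _ := GRing.isSubmodClosed.Build R[i] (X -> R[i])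
  square_summable_pred square_summable_submod.

Record ell2 := Ell2 { ell2_val : X -> R[i]; _ : ell2_val \in square_summable_pred }.

HB.instance Definition _ := [isSub for ell2_val].
HB.instance Definition _ := [Choice of ell2 by <:].
HB.instance Definition _ := [SubChoice_isSubLmodule of ell2 by <:].

Implicit Types (u v w : ell2) (a : R[i]).

Lemma ell2P u : square_summable (ell2_val u).
Proof. by case: u => u /= /asboolP. Qed.

Definition ell2_of (f : X -> R[i]) (Hf : square_summable f) : ell2 :=
  Ell2 (introT (asboolP (square_summable f)) Hf).

Lemma ell2_eq u v : (forall x, ell2_val u x = ell2_val v x) -> u = v.
Proof. by move=> H; apply: val_inj; apply/funext. Qed.

Lemma ell2_linE a u v x : ell2_val (a *: u + v) x = a * ell2_val u x + ell2_val v x.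
Proof. by []. Qed.

Definition ip u v : R := inner (ell2_val u) (ell2_val v).

Lemma ipC u v : ip u v = ip v u.
Proof. by apply: inner_eq => x; exact: cdotC. Qed.

Lemma ipDl u v w : ip (u + v) w = ip u w + ip v w.
Proof.
apply: cvg_lim => //.
have -> : dot_on (ell2_val (u + v)) (ell2_val w) =
    dot_on (ell2_val u) (ell2_val w) \+ dot_on (ell2_val v) (ell2_val w).
  by apply/funext => s; rewrite /dot_on /= -big_split; apply: eq_bigr => x _; exact: cdotDl.
by apply: cvgD; apply: innerP; exact: ell2P.
Qed.

Lemma ipZ a u v : ip (a *: u) v = ip u (Num.conj a *: v).
Proof. by apply: inner_eq => x; exact: cdotZ. Qed.

Lemma ipDr u v w : ip u (v + w) = ip u v + ip u w.
Proof. by rewrite ipC ipDl !(ipC u). Qed.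

Lemma ip0l u : ip 0 u = 0.
Proof. by apply: (@addIr _ (ip 0 u)); rewrite -ipDl !add0r. Qed.

Lemma ipNl u v : ip (- u) v = - ip u v.
Proof. by apply/eqP; rewrite -addr_eq0 -ipDl addNr ip0l. Qed.

Lemma ipBl u v w : ip (u - v) w = ip u w - ip v w.
Proof. by rewrite ipDl ipNl. Qed.

Lemma ipNr u v : ip u (- v) = - ip u v.
Proof. by rewrite ipC ipNl ipC. Qed.

Lemma ipBr u v w : ip u (v - w) = ip u v - ip u w.
Proof. by rewrite ipDr ipNr. Qed.

Lemma ip_ge0 u : 0 <= ip u u.
Proof.
have := dot_on_le_inner (s := [::]) (ell2P u) isT.
by rewrite /dot_on big_nil.
Qed.

Lemma cdot_le_ip u x : cdot (ell2_val u x) (ell2_val u x) <= ip u u.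
Proof.
have := dot_on_le_inner (s := [:: x]) (ell2P u) isT.
by rewrite /dot_on big_seq1.
Qed.

Lemma ip_eq0 u : ip u u = 0 -> u = 0.
Proof.
move=> u0; apply: ell2_eq => x; apply: cdot_eq0; apply/eqP.
by rewrite eq_le cdot_ge0 -u0 cdot_le_ip.
Qed.

Lemma ip_ext u v : (forall w, ip u w = ip v w) -> u = v.
Proof.
move=> H; apply/eqP; rewrite -subr_eq0; apply/eqP; apply: ip_eq0.
by rewrite ipBl H subrr.
Qed.

Lemma ipZZ a u : ip (a *: u) (a *: u) = cdot a a * ip u u.
Proof.
apply: cvg_lim => //.
have -> : dot_on (ell2_val (a *: u)) (ell2_val (a *: u)) =
    (fun s => cdot a a * dot_on (ell2_val u) (ell2_val u) s).
  by apply/funext => s; rewrite /dot_on mulr_sumr; apply: eq_bigr => x _; exact: cdotZZ.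
by apply: cvgMl_tmp; apply: innerP; exact: ell2P.
Qed.

Lemma ipZr_real (r : R) u v : ip u (r%:C%C *: v) = r * ip u v.
Proof.
apply: cvg_lim => //.
have -> : dot_on (ell2_val u) (ell2_val (r%:C%C *: v)) =
    (fun s => r * dot_on (ell2_val u) (ell2_val v) s).
  by apply/funext => s; rewrite /dot_on mulr_sumr; apply: eq_bigr => x _; exact: cdotRr.
by apply: cvgMl_tmp; apply: innerP; exact: ell2P.
Qed.

Definition nrm u : R := Num.sqrt (ip u u).

Lemma nrm_ge0 u : 0 <= nrm u. Proof. exact: sqrtr_ge0. Qed.
Lemma nrm_sqr u : nrm u ^+ 2 = ip u u. Proof. by rewrite sqr_sqrtr// ip_ge0. Qed.
Lemma nrm_eq0 u : nrm u = 0 -> u = 0.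
Proof. by move=> u0; apply: ip_eq0; rewrite -nrm_sqr u0 expr0n. Qed.
Lemma nrm0 : nrm 0 = 0.
Proof. by rewrite /nrm ip0l sqrtr0. Qed.

Lemma nrmZ a u : nrm (a *: u) = complex.Re `|a| * nrm u.
Proof.
have a0 : 0 <= complex.Re `|a| by rewrite -ler0c RRe_real ?ger0_real.
apply/eqP; rewrite -(@eqrXn2 _ 2) ?mulr_ge0 ?nrm_ge0// exprMn !nrm_sqr ipZZ; apply/eqP.
congr (_ * _); apply: (@complexI R); rewrite -cdot_norm rmorphXn/=.
by congr (_ ^+ _); rewrite RRe_real ?ger0_real.
Qed.

Lemma ip_le u v : ip u v <= nrm u * nrm v.
Proof.
have [u0|u0] := eqVneq (nrm u) 0; first by rewrite u0 mul0r (nrm_eq0 u0) ip0l.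
have [v0|v0] := eqVneq (nrm v) 0; first by rewrite v0 mulr0 (nrm_eq0 v0) ipC ip0l.
have u1 : 0 < nrm u by rewrite lt0r u0 nrm_ge0.
have v1 : 0 < nrm v by rewrite lt0r v0 nrm_ge0.
have := ip_ge0 ((nrm v)%:C%C *: u - (nrm u)%:C%C *: v).
rewrite ipBl !ipBr !ipZr_real ![ip (_ *: _) _]ipC !ipZr_real -!nrm_sqr (ipC v u) => H.
have H2 : 0 <= nrm u * nrm v * (nrm u * nrm v - ip u v) by move: H; lra.
by rewrite -subr_ge0 -(pmulr_rge0 _ (mulr_gt0 u1 v1)).
Qed.

Lemma nrmD u v : nrm (u + v) <= nrm u + nrm v.
Proof.
rewrite -(@ler_pXn2r _ 2) ?nnegrE ?addr_ge0 ?nrm_ge0// nrm_sqr ipDl !ipDr (ipC v u).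
rewrite -!nrm_sqr; have := ip_le u v; nra.
Qed.

Lemma nrmN u : nrm (- u) = nrm u.
Proof. by rewrite /nrm ipNl ipNr opprK. Qed.

End Ell2.

(** * Bounded operators with adjoints *)

Section BoundedOperators.
Variables (R : realType) (X : choiceType).
Local Notation H := (ell2 R X).
Implicit Types (u v w : H) (a : R[i]).

Definition bounded_by (f : H -> H) (M : R) := 0 <= M /\ forall u, nrm (f u) <= M * nrm u.

Definition adjoint_pair (f g : H -> H) := forall u v, ip (f u) v = ip u (g v).

(** The existence of an adjoint is part of the predicate, and [bop_adj] chooses it; for a limit of
    operators it is supplied by the limit of the adjoints. *)
Definition bounded_adjointable (f : H -> H) :=
  [/\ forall a u v, f (a *: u + v) = a *: f u + f v,
      exists g, adjoint_pair f g & exists M, bounded_by f M].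

Lemma adjoint_pair_sym f g : adjoint_pair f g -> adjoint_pair g f.
Proof. by move=> fg u v; rewrite ipC -fg ipC. Qed.

Lemma adjoint_pair_unique f g g' : adjoint_pair f g -> adjoint_pair f g' -> g = g'.
Proof.
by move=> H1 H2; apply/funext => v; apply: ip_ext => w; rewrite !(ipC _ w) -H1 -H2.
Qed.

Lemma adjoint_bounded_by f g M : adjoint_pair f g -> bounded_by f M -> bounded_by g M.
Proof.
move=> fg [M0 fM]; split=> // v; have [g0|g0] := eqVneq (nrm (g v)) 0.
  by rewrite g0 mulr_ge0// nrm_ge0.
have g1 : 0 < nrm (g v) by rewrite lt0r g0 nrm_ge0.
rewrite -(ler_pM2l g1) -expr2 nrm_sqr -fg mulrA.
apply: le_trans (ip_le _ _) _; rewrite ler_wpM2r ?nrm_ge0// mulrC; exact: fM.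
Qed.

Lemma linear_scale (f : H -> H) : (forall a u v, f (a *: u + v) = a *: f u + f v) ->
  forall a u, f (a *: u) = a *: f u.
Proof.
move=> f_lin a u; have f0 : f 0 = 0.
  by have := f_lin (-1) 0 0; rewrite scaler0 add0r scaleN1r addNr.
by have := f_lin a u 0; rewrite f0 !addr0.
Qed.

Lemma adjoint_linear f g : (forall a u v, f (a *: u + v) = a *: f u + f v) ->
  adjoint_pair f g -> forall a u v, g (a *: u + v) = a *: g u + g v.
Proof.
move=> f_lin fg a u v; apply: ip_ext => w.
have fZ := linear_scale f_lin.
rewrite ![ip _ w]ipC -fg !ipDr -[a in a *: u]conjCK -ipZ -fZ fg.
by rewrite -[in RHS](conjCK a) -ipZ fg.
Qed.

Lemma bounded_adjointable_adjoint f g : bounded_adjointable f -> adjoint_pair f g ->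
  bounded_adjointable g.
Proof.
case=> f_lin _ [M fM] fg; split; first exact: adjoint_linear fg.
  by exists f; exact: adjoint_pair_sym.
by exists M; exact: adjoint_bounded_by fM.
Qed.

Definition bounded_op_pred : {pred H -> H} := fun f => `[< bounded_adjointable f >].

Lemma bounded_byD (a : R[i]) f g M M' : bounded_by f M -> bounded_by g M' ->
  bounded_by (fun u => a *: f u + g u) (complex.Re `|a| * M + M').
Proof.
move=> [M0 fM] [M'0 gM]; have a0 : 0 <= complex.Re `|a| by rewrite -ler0c RRe_real ?ger0_real.
split=> [|u]; first by rewrite addr_ge0// mulr_ge0.
apply: le_trans (nrmD _ _) _; rewrite mulrDl nrmZ -mulrA.
by rewrite lerD// ler_wpM2l.
Qed.

Lemma bounded_op_submod : GRing.submod_closed bounded_op_pred.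
Proof.
split=> [|a f g].
  apply/asboolP; split=> [a u v||]; first by rewrite scaler0 addr0.
    by exists (fun=> 0) => u v; rewrite ip0l ipC ip0l.
  by exists 0; split=> // u; rewrite nrm0 mul0r.
move=> /asboolP[f_lin [f' ff] [M fM]] /asboolP[g_lin [g' gg] [M' gM]].
apply/asboolP; split=> [b u v||].
- rewrite !fctE f_lin g_lin !scalerDr !scalerA [a * b]mulrC.
  by rewrite addrACA.
- exists (fun v => Num.conj a *: f' v + g' v) => u v.
  by rewrite !fctE ipDl ipDr -(linear_scale f_lin) ff gg ipZ.
- by exists (complex.Re `|a| * M + M'); exact: bounded_byD.
Qed.

HB.instance Definition _ := GRing.isSubmodClosed.Build R[i] (H -> H)
  bounded_op_pred bounded_op_submod.

Record bop := Bop { bop_fun :> H -> H; _ : bop_fun \in bounded_op_pred }.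

HB.instance Definition _ := [isSub for bop_fun].
HB.instance Definition _ := [Choice of bop by <:].
HB.instance Definition _ := [SubChoice_isSubLmodule of bop by <:].

Implicit Types (S T : bop).

Lemma bopP T : bounded_adjointable T.
Proof. by case: T => f /= /asboolP. Qed.

Definition bop_of f (Hf : bounded_adjointable f) : bop :=
  Bop (introT (asboolP (bounded_adjointable f)) Hf).

Lemma bop_eq S T : (forall u, S u = T u) -> S = T.
Proof. by move=> ST; apply: val_inj; apply/funext. Qed.

Lemma bop_lin T a u v : T (a *: u + v) = a *: T u + T v.
Proof. by have [H1 _ _] := bopP T; exact: H1. Qed.

Lemma bop_linE a S T u : (a *: S + T) u = a *: S u + T u.
Proof. by []. Qed.

Definition bop_adj T : H -> H :=
  projT1 (cid (let: And3 _ H1 _ := bopP T in H1)).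

Lemma bop_adjP T : adjoint_pair T (bop_adj T).
Proof. exact: (projT2 (cid _)). Qed.

Definition bop_star T : bop :=
  bop_of (bounded_adjointable_adjoint (bopP T) (@bop_adjP T)).

Lemma bop_starP T u v : ip (T u) v = ip u (bop_star T v).
Proof. exact: bop_adjP. Qed.

Lemma bop_star_unique S T : adjoint_pair S T -> bop_star S = T.
Proof.
by move=> ST; apply: bop_eq => u; rewrite -(adjoint_pair_unique (@bop_adjP S) ST).
Qed.

Lemma bounded_by_comp f g M M' : bounded_by f M -> bounded_by g M' ->
  bounded_by (f \o g) (M * M').
Proof.
move=> [M0 fM] [M'0 gM]; split=> [|u]; first exact: mulr_ge0.
by apply: le_trans (fM _) _; rewrite -mulrA ler_wpM2l.
Qed.

Lemma bounded_adjointable_comp f g : bounded_adjointable f -> bounded_adjointable g ->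
  bounded_adjointable (f \o g).
Proof.
move=> [f_lin [f' ff] [M fM]] [g_lin [g' gg] [M' gM]]; split=> [a u v||].
- by rewrite /= g_lin f_lin.
- by exists (g' \o f') => u v; rewrite /= ff gg.
- by exists (M * M'); exact: bounded_by_comp.
Qed.

Definition bop_mul S T : bop := bop_of (bounded_adjointable_comp (bopP S) (bopP T)).

Definition opnorm T : R := inf [set M | bounded_by T M].

Lemma opnorm_has_inf T : has_inf [set M | bounded_by T M].
Proof. by split; [have [_ _] := bopP T | exists 0 => M []]. Qed.

Lemma opnorm_le T M : bounded_by T M -> opnorm T <= M.
Proof. by move=> TM; apply: ge_inf; [have [] := opnorm_has_inf T | ]. Qed.

Lemma opnorm_ge0 T : 0 <= opnorm T.
Proof. by apply: lb_le_inf; [have [] := opnorm_has_inf T | move=> M []]. Qed.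

Lemma le_opnorm T u : nrm (T u) <= opnorm T * nrm u.
Proof.
have [u0|u0] := eqVneq (nrm u) 0.
  by have [M [_ /(_ u)]] := (opnorm_has_inf T).1; rewrite u0 !mulr0.
have u1 : 0 < nrm u by rewrite lt0r u0 nrm_ge0.
rewrite -ler_pdivrMr//; apply: lb_le_inf; first by have [] := opnorm_has_inf T.
by move=> M [_ TM]; rewrite /= ler_pdivrMr.
Qed.

Lemma opnorm_bounded T : bounded_by T (opnorm T).
Proof. by split; [exact: opnorm_ge0 | exact: le_opnorm]. Qed.

Definition bop_norm T : R[i] := (opnorm T)%:C%C.

Lemma bop_normD S T : bop_norm (S + T) <= bop_norm S + bop_norm T.
Proof.
rewrite -rmorphD lecR; apply: opnorm_le.
have := bounded_byD 1 (opnorm_bounded S) (opnorm_bounded T).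
have -> : complex.Re `|1 : R[i]| = 1 by rewrite normr1.
rewrite [1 * _]mul1r => -[H1 H2]; split; first exact: H1.
by move=> u; have := H2 u; rewrite scale1r.
Qed.

Lemma bop_normZ a T : bop_norm (a *: T) = `|a| * bop_norm T.
Proof.
have a0 : 0 <= complex.Re `|a| by rewrite -ler0c RRe_real ?ger0_real.
have -> : `|a| = (complex.Re `|a|)%:C%C by rewrite RRe_real ?ger0_real.
rewrite -rmorphM; congr (_%:C%C); apply/eqP; rewrite eq_le; apply/andP; split.
  apply: opnorm_le; split=> [|u]; first by rewrite mulr_ge0 ?opnorm_ge0.
  by rewrite [(a *: T) u]/= nrmZ -mulrA ler_wpM2l ?le_opnorm.
have [->|a_neq0] := eqVneq a 0; first by rewrite normr0 mul0r opnorm_ge0.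
have a1 : 0 < complex.Re `|a| by rewrite -ltcR RRe_real ?ger0_real// normr_gt0.
rewrite -ler_pdivlMl//; apply: opnorm_le; split=> [|u].
  by rewrite mulr_ge0 ?invr_ge0// opnorm_ge0.
rewrite -mulrA ler_pdivlMl// -nrmZ; exact: (le_opnorm (a *: T)).
Qed.

Lemma bop_norm_eq0 T : bop_norm T = 0 -> T = 0.
Proof.
move=> /complexI T0; apply: bop_eq => u; apply: nrm_eq0.
by apply/eqP; rewrite eq_le nrm_ge0 andbT; have := le_opnorm T u; rewrite T0 mul0r.
Qed.

HB.instance Definition _ := Lmodule_isNormed.Build R[i] bop bop_normD bop_normZ bop_norm_eq0.

Lemma bop_normE T : `|T| = (opnorm T)%:C%C. Proof. by []. Qed.

End BoundedOperators.

(** * Completeness and the C*-algebra of operators *)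

Section OperatorLimits.
Variables (R : realType) (X : choiceType).
Local Notation H := (ell2 R X).
Local Notation BH := (bop R X).
Implicit Types (u v w : H) (S T : BH).

Lemma bop_ballE S T (e : R) : ball S e%:C%C T <-> opnorm (S - T) < e.
Proof. by rewrite -ball_normE/= /ball_/= bop_normE ltcR. Qed.

Lemma nrm_small_eq0 u (C : R) : (forall e, 0 < e -> nrm u <= e * C) -> u = 0.
Proof.
move=> Hu; apply: nrm_eq0; apply/eqP; rewrite eq_le nrm_ge0 andbT.
apply/ler_addgt0Pr => e e0; rewrite add0r.
have C1 : 0 < `|C| + 1 by rewrite ltr_wpDl.
have := Hu (e / (`|C| + 1)) (divr_gt0 e0 C1) => H1; apply: le_trans H1 _.
rewrite mulrAC ler_pdivrMr// ler_pM2l//; have := ler_norm C; lra.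
Qed.

Lemma nrm_sub_sym u v : nrm (u - v) = nrm (v - u).
Proof. by rewrite -nrmN opprB. Qed.

Lemma Re_le_nrm u x : `|complex.Re (ell2_val u x)| <= nrm u.
Proof.
rewrite -(@ler_pXn2r _ 2) ?nnegrE ?nrm_ge0// real_normK ?num_real// nrm_sqr.
apply: le_trans (cdot_le_ip u x); rewrite /cdot expr2 lerDl; exact: sqr_ge0.
Qed.

Lemma Im_le_nrm u x : `|complex.Im (ell2_val u x)| <= nrm u.
Proof.
rewrite -(@ler_pXn2r _ 2) ?nnegrE ?nrm_ge0// real_normK ?num_real// nrm_sqr.
apply: le_trans (cdot_le_ip u x); rewrite /cdot expr2 lerDr; exact: sqr_ge0.
Qed.

Section Limit.
Variables (F : set_system BH).
Hypothesis FF : ProperFilter F.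
Hypothesis F_cauchy : cauchy F.
Variable phi : BH -> H -> H.
Hypothesis phi_lip : forall S T u, nrm (phi S u - phi T u) <= opnorm (S - T) * nrm u.

Lemma cauchy_bop (e : R) : 0 < e -> exists T, F [set S | opnorm (T - S) < e].
Proof.
move=> e0; have /cauchyP/(_ e%:C%C) [|T FT] := F_cauchy; first by rewrite ltcR.
by exists T; apply: filterS FT => S /= /bop_ballE.
Qed.

Lemma cauchy_coordinate (g : H -> R) u :
  (forall v w, `|g v - g w| <= nrm (v - w)) -> cvg ((fun T => g (phi T u)) @ F).
Proof.
move=> g_lip; apply/cauchy_cvgP; apply/cauchyP => e e0.
have u1 : 0 < nrm u + 1 by rewrite ltr_wpDl// nrm_ge0.
have [T FT] := cauchy_bop (divr_gt0 e0 u1).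
exists (g (phi T u)); rewrite -[_ (ball _ _)]/(F [set S | ball (g (phi T u)) e (g (phi S u))]).
apply: filterS FT => S /=; rewrite ltr_pdivlMr// => H1.
rewrite -ball_normE/= /ball_/=; apply: le_lt_trans (g_lip _ _) _.
apply: le_lt_trans (phi_lip _ _ _) _; apply: le_lt_trans H1.
by rewrite ler_wpM2l ?opnorm_ge0// lerDl.
Qed.

Definition coord_lim u x : R[i] :=
  Complex (lim ((fun T => complex.Re (ell2_val (phi T u) x)) @ F))
          (lim ((fun T => complex.Im (ell2_val (phi T u) x)) @ F)).

Lemma Re_coord_cvg u x :
  (fun T => complex.Re (ell2_val (phi T u) x)) @ F --> complex.Re (coord_lim u x).
Proof.
apply: (cauchy_coordinate (g := fun v => complex.Re (ell2_val v x))) => v w.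
by have := Re_le_nrm (v - w) x; rewrite [ell2_val _ _]/= raddfB.
Qed.

Lemma Im_coord_cvg u x :
  (fun T => complex.Im (ell2_val (phi T u) x)) @ F --> complex.Im (coord_lim u x).
Proof.
apply: (cauchy_coordinate (g := fun v => complex.Im (ell2_val v x))) => v w.
by have := Im_le_nrm (v - w) x; rewrite [ell2_val _ _]/= raddfB.
Qed.

(** Only finitely many coordinates enter, so the limit passes through the sum. As the bound is
    uniform in [s], it yields both square summability and a norm estimate for the limit. *)
Lemma dot_on_coord_lim u w s M : uniq s -> 0 <= M ->
  F [set T | nrm (phi T u - w) <= M] ->
  dot_on (fun x => coord_lim u x - ell2_val w x) (fun x => coord_lim u x - ell2_val w x) s
    <= M ^+ 2.
Proof.
move=> us M0 FM.
have cv : (fun T => dot_on (ell2_val (phi T u - w)) (ell2_val (phi T u - w)) s) @ F -->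
    dot_on (fun x => coord_lim u x - ell2_val w x) (fun x => coord_lim u x - ell2_val w x) s.
  have cvRe x : (fun T => complex.Re (ell2_val (phi T u - w) x)) @ F -->
      complex.Re (coord_lim u x - ell2_val w x).
    rewrite raddfB; under eq_cvg do rewrite [ell2_val _ _]/= raddfB.
    by apply: cvgB; [exact: Re_coord_cvg | exact: cvg_cst].
  have cvIm x : (fun T => complex.Im (ell2_val (phi T u - w) x)) @ F -->
      complex.Im (coord_lim u x - ell2_val w x).
    rewrite raddfB; under eq_cvg do rewrite [ell2_val _ _]/= raddfB.
    by apply: cvgB; [exact: Im_coord_cvg | exact: cvg_cst].
  elim: s {us} => [|x s IH].
    by rewrite /dot_on big_nil; under eq_cvg do rewrite big_nil; exact: cvg_cst.
  rewrite /dot_on big_cons; under eq_cvg do rewrite big_cons.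
  by apply: cvgD; [apply: cvgD; apply: cvgM | exact: IH].
apply: (cvgr_to_le cv); apply: filterS FM => T TM.
apply: le_trans (dot_on_le_inner (ell2P (phi T u - w)) us) _; rewrite -/(ip _ _) -nrm_sqr.
by apply: lerXn2r; rewrite ?nnegrE ?nrm_ge0.
Qed.

(** Stated for a general [phi] because it is applied twice, with [phi T] equal to [T] and to
    [bop_star T]; the second limit is the adjoint of the first. *)
Lemma operator_limit : exists f : H -> H, forall (e : R) T, 0 < e ->
  F [set S | opnorm (T - S) < e] -> forall u, nrm (f u - phi T u) <= e * nrm u.
Proof.
have near (e : R) T u : 0 < e -> F [set S | opnorm (T - S) < e] ->
    F [set S | nrm (phi S u - phi T u) <= e * nrm u].
  move=> e0; apply: filterS => S /= TS.
  rewrite nrm_sub_sym; apply: le_trans (phi_lip _ _ _) _.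
  by rewrite ler_wpM2r ?nrm_ge0// ltW.
have sq u : square_summable (coord_lim u).
  have [T FT] := cauchy_bop ltr01.
  have S1 : square_summable (fun x => coord_lim u x - ell2_val (phi T u) x).
    exists ((1 * nrm u) ^+ 2) => s us; apply: dot_on_coord_lim => //.
      by rewrite mulr_ge0// nrm_ge0.
    exact: near FT.
  have := square_summableD S1 (ell2P (phi T u)).
  by congr square_summable; apply/funext => x /=; rewrite subrK.
exists (fun u => ell2_of (sq u)) => e T e0 FT u.
rewrite -(@ler_pXn2r _ 2) ?nnegrE ?nrm_ge0// ?mulr_ge0 ?nrm_ge0 ?(ltW e0)//.
rewrite nrm_sqr; apply: inner_le => s us.
apply: dot_on_coord_lim => //; first by rewrite mulr_ge0 ?nrm_ge0 ?(ltW e0).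
exact: near FT.
Qed.

End Limit.

Lemma opnorm_star_le T : opnorm (bop_star T) <= opnorm T.
Proof.
apply: opnorm_le; apply: adjoint_bounded_by (opnorm_bounded T).
exact: bop_starP.
Qed.

Lemma bop_star_sub S T : bop_star (S - T) = bop_star S - bop_star T.
Proof.
apply: bop_star_unique => u v.
by rewrite [(S - T) u]/= [(bop_star S - bop_star T) v]/= ipBl ipBr !bop_starP.
Qed.

Lemma bop_complete (F : set_system BH) : ProperFilter F -> cauchy F -> cvg F.
Proof.
move=> FF Fc.
have [|f fP] := operator_limit FF Fc (phi := fun T => T).
  by move=> S T u; exact: (le_opnorm (S - T)).
have [|g gP] := operator_limit FF Fc (phi := fun T => bop_star T).
  move=> S T u; rewrite -[_ - _]/((bop_star S - bop_star T) u) -bop_star_sub.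
  apply: le_trans (le_opnorm _ _) _; rewrite ler_wpM2r ?nrm_ge0//; exact: opnorm_star_le.
have f_adj : adjoint_pair f g.
  have le u v (r : R) : 0 < r -> `|ip (f u) v - ip u (g v)| <= r * (2 * (nrm u * nrm v)).
    move=> r0; have [T FT] := cauchy_bop FF Fc r0.
    have -> : ip (f u) v - ip u (g v) = ip (f u - T u) v - ip u (g v - bop_star T v).
      rewrite ipBl ipBr bop_starP; lra.
    have i1 := ip_le (f u - T u) v; have i2 := ip_le u (g v - bop_star T v).
    have i3 := ip_le (- (f u - T u)) v; have i4 := ip_le (- u) (g v - bop_star T v).
    rewrite ipNl nrmN in i3; rewrite ipNl nrmN in i4.
    have j1 := fP _ _ r0 FT u; have j2 := gP _ _ r0 FT v.
    have l1 : nrm (f u - T u) * nrm v <= r * (nrm u * nrm v).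
      by rewrite mulrA ler_wpM2r ?nrm_ge0.
    have l2 : nrm u * nrm (g v - bop_star T v) <= r * (nrm u * nrm v).
      by rewrite mulrCA ler_wpM2l ?nrm_ge0.
    rewrite ler_norml; apply/andP; split; lra.
  move=> u v; apply/eqP; rewrite -subr_eq0 -normr_le0; apply/ler_addgt0Pr => r r0.
  rewrite add0r; set C := 2 * (nrm u * nrm v).
  have C1 : 0 < C + 1 by rewrite ltr_wpDl// !mulr_ge0 ?nrm_ge0.
  apply: le_trans (le u v _ (divr_gt0 r0 C1)) _.
  rewrite -/C mulrAC ler_pdivrMr// ler_pM2l//; lra.
have f_lin a u v : f (a *: u + v) = a *: f u + f v.
  apply/eqP; rewrite -subr_eq0; apply/eqP.
  pose C := nrm (a *: u + v) + complex.Re `|a| * nrm u + nrm v.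
  apply: (@nrm_small_eq0 _ C) => e e0; have [T FT] := cauchy_bop FF Fc e0.
  have -> : f (a *: u + v) - (a *: f u + f v) =
      (f (a *: u + v) - T (a *: u + v)) - (a *: (f u - T u) + (f v - T v)).
    by rewrite bop_lin scalerBr [_ - _ + (f v - _)]addrACA -opprD [in RHS]opprB addrA subrK.
  apply: le_trans (nrmD _ _) _; rewrite nrmN.
  apply: le_trans (lerD (lexx _) (nrmD _ _)) _; rewrite nrmZ.
  have j1 := fP _ _ e0 FT (a *: u + v); have j2 := fP _ _ e0 FT u; have j3 := fP _ _ e0 FT v.
  have a0 : 0 <= complex.Re `|a| by rewrite -ler0c RRe_real ?ger0_real.
  have j4 := ler_wpM2l a0 j2; rewrite /C; lra.
have f_bounded : bounded_adjointable f.
  split=> //; first by exists g.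
  have [T FT] := cauchy_bop FF Fc ltr01.
  exists (1 + opnorm T); split=> [|u]; first by rewrite addr_ge0// opnorm_ge0.
  have := nrmD (f u - T u) (T u); rewrite subrK.
  have := fP _ _ ltr01 FT u; have := le_opnorm T u; lra.
apply/cvg_ex; exists (bop_of f_bounded); apply/cvgrPdist_lt => e e0.
have eE : e = (complex.Re e)%:C%C by rewrite RRe_real// gtr0_real.
have er : 0 < complex.Re e / 2 by rewrite divr_gt0// -ltcR -eE.
have [T FT] := cauchy_bop FF Fc er.
apply: (filterS _ FT) => S /= TS; rewrite bop_normE eE ltcR.
have := bop_normD (bop_of f_bounded - T) (T - S).
rewrite addrA subrK -rmorphD lecR => H1; apply: le_lt_trans H1 _.
rewrite [ltRHS]splitr; apply: ler_ltD TS.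
apply: opnorm_le; split=> [|u]; first exact: ltW.
exact: (fP _ _ er FT u).
Qed.

HB.instance Definition _ := Uniform_isComplete.Build BH bop_complete.

Lemma bop_mulA : associative (@bop_mul R X).
Proof. by move=> S T U; apply: bop_eq. Qed.

Lemma bop_mul_linearl (a : R[i]) S T U :
  bop_mul (a *: S + T) U = a *: bop_mul S U + bop_mul T U.
Proof. by apply: bop_eq. Qed.

Lemma bop_mul_linearr (a : R[i]) S T U :
  bop_mul S (a *: T + U) = a *: bop_mul S T + bop_mul S U.
Proof. by apply: bop_eq => u; exact: bop_lin. Qed.

Lemma bop_starK : involutive (@bop_star R X).
Proof. by move=> T; apply: bop_star_unique; apply: adjoint_pair_sym; exact: bop_starP. Qed.

Lemma bop_star_antilinear (a : R[i]) S T :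
  bop_star (a *: S + T) = Num.conj a *: bop_star S + bop_star T.
Proof.
apply: bop_star_unique => u v; rewrite !bop_linE.
by rewrite ipDl ipDr -(linear_scale (bop_lin S)) !bop_starP ipZ.
Qed.

Lemma bop_starM S T : bop_star (bop_mul S T) = bop_mul (bop_star T) (bop_star S).
Proof. by apply: bop_star_unique => u v; rewrite /= !bop_starP. Qed.

Lemma bop_normM S T : `|bop_mul S T| <= `|S| * `|T|.
Proof.
rewrite !bop_normE -rmorphM lecR; apply: opnorm_le.
exact: bounded_by_comp (opnorm_bounded S) (opnorm_bounded T).
Qed.

Lemma bop_norm_star T : `|bop_mul (bop_star T) T| = `|T| ^+ 2.
Proof.
rewrite !bop_normE -rmorphXn; congr (_%:C%C); apply/eqP; rewrite eq_le; apply/andP; split.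
  apply: (@le_trans _ _ (opnorm (bop_star T) * opnorm T)).
    apply: opnorm_le; exact: bounded_by_comp (opnorm_bounded _) (opnorm_bounded T).
  by rewrite expr2 ler_wpM2r ?opnorm_ge0// opnorm_star_le.
rewrite -[leRHS]sqr_sqrtr ?opnorm_ge0//; apply: lerXn2r; rewrite ?nnegrE ?opnorm_ge0 ?sqrtr_ge0//.
apply: opnorm_le; split=> [|u]; first exact: sqrtr_ge0.
rewrite -(@ler_pXn2r _ 2) ?nnegrE ?mulr_ge0 ?nrm_ge0 ?sqrtr_ge0// exprMn.
rewrite [X in _ <= X * _]sqr_sqrtr ?opnorm_ge0//.
rewrite [leLHS]nrm_sqr bop_starP; apply: le_trans (ip_le _ _) _.
apply: le_trans (ler_wpM2l (nrm_ge0 u) (le_opnorm (bop_mul (bop_star T) T) u)) _.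
by rewrite expr2 mulrCA.
Qed.

HB.instance Definition _ := CompleteNormedModule_isCStarAlgebra.Build R BH
  bop_mulA bop_mul_linearl bop_mul_linearr bop_starK bop_star_antilinear
  bop_starM bop_normM bop_norm_star.

End OperatorLimits.

(** * The path-space representation *)

Section PartialInjections.
Variables (R : realType) (Y : choiceType) (a : Y -> R[i]) (f : Y -> Y).
Hypothesis a_unimodular : forall y, a y != 0 -> `|a y| = 1.
Hypothesis f_inj : forall y y', a y != 0 -> a y' != 0 -> f y = f y' -> y = y'.
Local Notation H := (ell2 R Y).
Implicit Types (u v : Y -> R[i]) (x y : Y).

Definition partial_inv x : option Y :=
  match pselect (exists y, a y != 0 /\ f y = x) with
  | left e => Some (projT1 (cid e))
  | right _ => None
  end.

Lemma partial_invP x y : partial_inv x = Some y -> a y != 0 /\ f y = x.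
Proof. by rewrite /partial_inv; case: pselect => // e [<-]; case: cid. Qed.

Lemma partial_invK y : a y != 0 -> partial_inv (f y) = Some y.
Proof.
rewrite /partial_inv => ay; case: pselect => [e|[]]; last by exists y.
by case: cid => z /= [az fz]; congr Some; exact: f_inj.
Qed.

(** The partial isometry [e_y |-> a y e_(f y)], whose domain is spanned by the support of [a];
    [pull] is its adjoint. *)
Definition push u x : R[i] := if partial_inv x is Some y then a y * u y else 0.
Definition pull u y : R[i] := Num.conj (a y) * u (f y).

Lemma push_image u y : a y != 0 -> push u (f y) = a y * u y.
Proof. by move=> ay; rewrite /push partial_invK. Qed.

Lemma push_eq0 u x : (forall y, a y != 0 -> f y <> x) -> push u x = 0.
Proof. by move=> Hx; rewrite /push; case E: partial_inv => [y|//]; have [/Hx] := partial_invP E. Qed.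

Lemma conj_unimodular y : a y != 0 -> Num.conj (a y) * a y = 1.
Proof. by move=> ay; rewrite mulrC -normCK a_unimodular// expr1n. Qed.

Lemma pull_push u y : pull (push u) y = if a y == 0 then 0 else u y.
Proof.
rewrite /pull; case: eqVneq => [->|ay]; first by rewrite rmorph0 mul0r.
by rewrite push_image// mulrA conj_unimodular// mul1r.
Qed.

Lemma push_pull u x : push (pull u) x = if partial_inv x then u x else 0.
Proof.
rewrite /push /pull; case E: partial_inv => [y|//]; have [ay <-] := partial_invP E.
by rewrite mulrA [a y * _]mulrC conj_unimodular// mul1r.
Qed.

Lemma dot_on_push u s : dot_on (push u) (push u) s = dot_on u u (pmap partial_inv s).
Proof.
elim: s => [|x s IH]; first by rewrite /dot_on !big_nil.
rewrite [LHS]/dot_on big_cons -/(dot_on _ _ s) IH /= /push.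
case E: partial_inv => [y|] /=; last by rewrite /cdot mul0r addr0 add0r.
have [ay _] := partial_invP E.
by rewrite [RHS]/dot_on big_cons cdotZZ cdot_norm1 ?mul1r// a_unimodular.
Qed.

Lemma dot_on_pull u s : dot_on (pull u) (pull u) s =
  dot_on u u [seq f y | y <- [seq y <- s | a y != 0]].
Proof.
elim: s => [|y s IH]; first by rewrite /dot_on !big_nil.
rewrite [LHS]/dot_on big_cons -/(dot_on _ _ s) IH /= /pull.
have [->|ay] /= := eqVneq (a y) 0; first by rewrite rmorph0 mul0r /cdot mul0r addr0 add0r.
by rewrite [RHS]/dot_on big_cons cdotZZ cdot_norm1 ?mul1r// norm_conjC a_unimodular.
Qed.

Lemma dot_on_push_le u s : square_summable u -> uniq s ->
  dot_on (push u) (push u) s <= inner u u.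
Proof.
move=> Hu us; rewrite dot_on_push; apply: dot_on_le_inner => //.
apply: (@pmap_uniq _ _ _ f) us => x.
by case E: partial_inv => [y|//] /=; have [] := partial_invP E.
Qed.

Lemma dot_on_pull_le u s : square_summable u -> uniq s ->
  dot_on (pull u) (pull u) s <= inner u u.
Proof.
move=> Hu us; rewrite dot_on_pull; apply: dot_on_le_inner => //.
rewrite map_inj_in_uniq ?seq.filter_uniq// => y y'.
by rewrite !mem_filter => /andP[ay _] /andP[ay' _]; exact: f_inj.
Qed.

Lemma push_summable (u : H) : square_summable (push (ell2_val u)).
Proof. by exists (ip u u) => s us; apply: dot_on_push_le => //; exact: ell2P. Qed.

Lemma pull_summable (u : H) : square_summable (pull (ell2_val u)).
Proof. by exists (ip u u) => s us; apply: dot_on_pull_le => //; exact: ell2P. Qed.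

Definition push_op (u : H) : H := ell2_of (push_summable u).
Definition pull_op (u : H) : H := ell2_of (pull_summable u).

Lemma push_opE (u : H) x : ell2_val (push_op u) x = push (ell2_val u) x.
Proof. by []. Qed.

Lemma push_op_lin (b : R[i]) (u v : H) : push_op (b *: u + v) = b *: push_op u + push_op v.
Proof.
apply: ell2_eq => x; rewrite ell2_linE !push_opE /push; case: partial_inv => [y|].
  by rewrite ell2_linE mulrDr mulrCA.
by rewrite mulr0 addr0.
Qed.

Lemma ip_push_le (u : H) : ip (push_op u) (push_op u) <= ip u u.
Proof. by apply: inner_le => s us; apply: dot_on_push_le => //; exact: ell2P. Qed.

Lemma ip_pull_le (u : H) : ip (pull_op u) (pull_op u) <= ip u u.
Proof. by apply: inner_le => s us; apply: dot_on_pull_le => //; exact: ell2P. Qed.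

(** Both maps are contractions, and push after pull after push is push again, so [pull_op] cannot
    lose norm on the range of [push_op]. *)
Lemma ip_push (u : H) : ip (push_op u) (push_op u) =
  ip (pull_op (push_op u)) (pull_op (push_op u)).
Proof.
apply/le_anti/andP; split; last exact: (ip_pull_le (push_op u)).
have {1 2}-> : push_op u = push_op (pull_op (push_op u)); last exact: ip_push_le.
apply: ell2_eq => x /=; rewrite push_pull /push; by case: partial_inv.
Qed.

Lemma ip_polarization (u v : H) : ip u v = 4^-1 * (ip (u + v) (u + v) - ip (u - v) (u - v)).
Proof. by rewrite !(ipDl, ipDr, ipNl, ipNr) (ipC v u); field. Qed.

(** Polarizing [ip_push] shows that [pull_op] preserves inner products on the range of [push_op].
    Moreover [v] may be replaced by [push_op (pull_op v)], since the two differ only where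
    [push_op u] vanishes. *)
Lemma push_adjoint : adjoint_pair push_op pull_op.
Proof.
have push_opD (u v : H) : push_op (u + v) = push_op u + push_op v.
  by have := push_op_lin 1 u v; rewrite !scale1r.
have pull_opD (u v : H) : pull_op (u + v) = pull_op u + pull_op v.
  by apply: ell2_eq => x; rewrite /= /pull /= mulrDr.
have push_opN (u : H) : push_op (- u) = - push_op u.
  apply/eqP; rewrite -addr_eq0 -push_opD addNr; apply/eqP/ell2_eq => x.
  by rewrite /= /push; case: partial_inv => // y; rewrite mulr0.
have pull_opN (u : H) : pull_op (- u) = - pull_op u.
  by apply: ell2_eq => x; rewrite /= /pull /= mulrN.
have iso (u v : H) : ip (push_op u) (push_op v) =
    ip (pull_op (push_op u)) (pull_op (push_op v)).
  rewrite ip_polarization [RHS]ip_polarization -!push_opN -!push_opD !ip_push.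
  by rewrite !push_opD !pull_opD !push_opN !pull_opN.
move=> u v.
have -> : ip (push_op u) v = ip (push_op u) (push_op (pull_op v)).
  apply: inner_eq => x /=; rewrite push_pull /push; case: partial_inv => //=.
  by rewrite /cdot !mul0r.
rewrite iso; apply: inner_eq => y /=; rewrite !pull_push /pull.
by case: eqVneq => // ->; rewrite rmorph0 mul0r /cdot !mulr0.
Qed.

Lemma push_bounded : bounded_adjointable push_op.
Proof.
split; first exact: push_op_lin.
  by exists pull_op; exact: push_adjoint.
exists 1; split=> // u; rewrite mul1r -(@ler_pXn2r _ 2) ?nnegrE ?nrm_ge0//.
by rewrite !nrm_sqr ip_push_le.
Qed.

Definition push_bop : bop R Y := bop_of push_bounded.
Definition pull_bop : bop R Y :=
  bop_of (bounded_adjointable_adjoint push_bounded push_adjoint).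

Lemma push_bop_star : push_bop^† = pull_bop.
Proof. exact: (bop_star_unique (S := push_bop) (T := pull_bop) push_adjoint). Qed.

End PartialInjections.

(** * The direct limit along an infinite path *)

Section PathSpace.
Variables (R : realType) (k : nat) (L : kgraph k) (c : L -> L -> R[i]).
Hypothesis L_row_finite : row_finite L.
Hypothesis L_no_sources : no_sources L.
Hypothesis c_cocycle : cocycle2 c.
Variable v0 : kg_vertex L.
Implicit Types (la mu nu eta ze : L) (m n j : nat) (y : nat * L).

Lemma deg_addI (d d1 d2 : {ffun 'I_k -> nat}) : d + d1 = d + d2 -> d1 = d2.
Proof.
by move=> /ffunP e; apply/ffunP => i; have := e i; rewrite !deg_addE => /addnI.
Qed.

Lemma kg_cancel mu nu mu' nu' : kg_src mu = kg_rng nu -> kg_src mu' = kg_rng nu' ->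
  kg_deg mu = kg_deg mu' -> kg_comp mu nu = kg_comp mu' nu' -> mu = mu' /\ nu = nu'.
Proof.
move=> s s' d e; have dn : kg_deg nu = kg_deg nu'.
  by apply: (@deg_addI (kg_deg mu)); rewrite -kg_deg_comp// e kg_deg_comp// d.
have [p [_ U]] := kg_factorisation (kg_deg_comp s).
have p1 : p = (mu, nu) by apply: U; split.
have p2 : p = (mu', nu') by apply: U; split.
by move: p2; rewrite p1 => -[].
Qed.

Lemma kg_cancelr mu mu' nu : kg_src mu = kg_rng nu -> kg_src mu' = kg_rng nu ->
  kg_comp mu nu = kg_comp mu' nu -> mu = mu'.
Proof.
move=> s s' e; have d : kg_deg mu = kg_deg mu'.
  by apply: (@deg_addI (kg_deg nu)); rewrite ![kg_deg nu + _]addrC -!kg_deg_comp// e.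
by have [] := kg_cancel s s' d e.
Qed.

(** With degree 1 in every coordinate, these paths compose to degrees that eventually dominate any
    given [n]. *)
Definition next_edge (v : kg_vertex L) : L :=
  projT1 (cid (L_no_sources v (cst_deg k 1))).

Lemma next_edge_rng v : kg_rng (next_edge v) = v.
Proof. by rewrite /next_edge; case: cid => e []. Qed.

Lemma next_edge_deg v : kg_deg (next_edge v) = cst_deg k 1.
Proof. by rewrite /next_edge; case: cid => e []. Qed.

(* The vertices and the segments of degree [(1, ..., 1)] of an infinite path
   with range [v0]. *)
Definition tail_vertex m : kg_vertex L := iter m (fun v => kg_src (next_edge v)) v0.
Definition tail_edge m : L := next_edge (tail_vertex m).

Lemma tail_edge_rng m : kg_rng (tail_edge m) = tail_vertex m.
Proof. exact: next_edge_rng. Qed.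

Lemma conj_cocycleK mu nu : kg_src mu = kg_rng nu -> c mu nu * Num.conj (c mu nu) = 1.
Proof. by case: c_cocycle => H _ _ /H H1; rewrite -normCK H1 expr1n. Qed.

(* The pair [(m, mu)], with [s(mu)] the [m]-th tail vertex, stands for a basis
   vector [e(m, mu)] subject to [e(m, eta) = c(eta, x_m) e(m+1, eta x_m)], where
   [x_m] is the [m]-th tail edge.  [nf m mu] is the pair with shortest first
   component representing the same line, together with the phase. *)
Fixpoint nf m mu : (nat * L) * R[i] :=
  if m is m'.+1 then
    match pselect (exists eta, kg_src eta = tail_vertex m' /\ mu = kg_comp eta (tail_edge m')) with
    | left e => let eta := projT1 (cid e) in
        ((nf m' eta).1, (nf m' eta).2 * Num.conj (c eta (tail_edge m')))
    | right _ => ((m, mu), 1)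
    end
  else ((0%N, mu), 1).

Lemma nf_comp m eta : kg_src eta = tail_vertex m ->
  nf m.+1 (kg_comp eta (tail_edge m)) =
  ((nf m eta).1, (nf m eta).2 * Num.conj (c eta (tail_edge m))).
Proof.
move=> s /=; case: pselect => [e|[]]; last by exists eta.
case: cid => eta' /= [s' e'].
by have -> : eta' = eta by apply: (kg_cancelr _ _ (esym e')); rewrite tail_edge_rng.
Qed.

Lemma nf_new m mu : (forall eta, kg_src eta = tail_vertex m -> mu <> kg_comp eta (tail_edge m)) ->
  nf m.+1 mu = ((m.+1, mu), 1).
Proof. by move=> Hmu /=; case: pselect => [[eta [s e]]|//]; case: (Hmu eta s e). Qed.

Variant nf_case m : L -> Prop :=
| NfComp eta of kg_src eta = tail_vertex m : nf_case m (kg_comp eta (tail_edge m))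
| NfNew mu of nf m.+1 mu = ((m.+1, mu), 1) : nf_case m mu.

Lemma nf_caseP m mu : nf_case m mu.
Proof.
have [[eta [s ->]]|H] := pselect (exists eta, kg_src eta = tail_vertex m /\
    mu = kg_comp eta (tail_edge m)); first exact: NfComp.
by apply: NfNew; apply: nf_new => eta s e; apply: H; exists eta.
Qed.

(** The reduced pairs index an orthonormal basis of the direct limit. The operators below act on l^2
    of all pairs and vanish on the other coordinates. *)
Definition reduced y : bool :=
  `[< kg_src y.2 = tail_vertex y.1 /\ nf y.1 y.2 = (y, 1) >].

Lemma nf_reduced m mu : kg_src mu = tail_vertex m ->
  [/\ reduced (nf m mu).1, kg_rng (nf m mu).1.2 = kg_rng mu & `|(nf m mu).2| = 1].
Proof.
elim: m mu => [|m IH] mu s; first by split; rewrite ?normr1//; apply/asboolP.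
case: (nf_caseP m mu) s => [eta s _|nu nE s].
  have se : kg_src eta = kg_rng (tail_edge m) by rewrite tail_edge_rng.
  rewrite nf_comp//=; have [H1 H2 H3] := IH _ s.
  split=> //; first by rewrite H2 kg_rng_comp.
  by rewrite normrM H3 norm_conjC; case: c_cocycle => -> //; rewrite mulr1.
by rewrite nE; split; rewrite ?normr1//; apply/asboolP.
Qed.

Lemma nf_level m mu : ((nf m mu).1.1 <= m)%N.
Proof.
elim: m mu => [|m IH] mu //=; case: pselect => [e|_] //=.
exact: leq_trans (IH _) _.
Qed.

(** Right multiplication by a tail edge is injective, and by [nf_level] a pair that is new at level
    [m.+1] differs from everything coming from below. *)
Lemma nf_inj m mu mu' : kg_src mu = tail_vertex m -> kg_src mu' = tail_vertex m ->
  (nf m mu).1 = (nf m mu').1 -> mu = mu'.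
Proof.
elim: m mu mu' => [|m IH] mu mu' s s'; first by move=> [].
case: (nf_caseP m mu) s => [eta se _|nu nE _]; case: (nf_caseP m mu') s' => [eta' se' _|nu' nE' _].
- by rewrite !nf_comp//= => e; rewrite (IH _ _ se se' e).
- rewrite nf_comp// nE' /= => e; have := nf_level m eta.
  by rewrite e /= ltnn.
- rewrite nf_comp// nE /= => e; have := nf_level m eta'.
  by rewrite -e /= ltnn.
- by rewrite nE nE' /= => -[].
Qed.

(** Gives the representative, at level [m + j], of the line of [(m, mu)]. *)
Fixpoint extend m mu j : L :=
  if j is j'.+1 then kg_comp (extend m mu j') (tail_edge (m + j')) else mu.

Lemma extend_src m mu j : kg_src mu = tail_vertex m -> kg_src (extend m mu j) = tail_vertex (m + j).
Proof.
move=> s; elim: j => [|j IH] /=; first by rewrite addn0.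
by rewrite kg_src_comp ?addnS// IH tail_edge_rng.
Qed.

Lemma extend_rng m mu j : kg_src mu = tail_vertex m -> kg_rng (extend m mu j) = kg_rng mu.
Proof.
move=> s; elim: j => [|j IH] //=.
by rewrite kg_rng_comp// extend_src// tail_edge_rng.
Qed.

Lemma extend_deg m mu j : kg_src mu = tail_vertex m ->
  kg_deg (extend m mu j) = kg_deg mu + cst_deg k j.
Proof.
move=> s; elim: j => [|j IH] /=.
  by apply/ffunP => i; rewrite deg_addE cst_degE addn0.
rewrite kg_deg_comp ?extend_src ?tail_edge_rng// IH next_edge_deg.
by apply/ffunP => i; rewrite !deg_addE !cst_degE; lia.
Qed.

Lemma nf_extend m mu j : kg_src mu = tail_vertex m ->
  (nf (m + j) (extend m mu j)).1 = (nf m mu).1.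
Proof.
move=> s; elim: j => [|j IH]; first by rewrite addn0.
by rewrite addnS nf_comp ?extend_src.
Qed.

Lemma extend_comp m la mu j : kg_src mu = tail_vertex m -> kg_src la = kg_rng mu ->
  extend m (kg_comp la mu) j = kg_comp la (extend m mu j).
Proof.
move=> s sl; elim: j => [|j IH] //=.
rewrite IH kg_compA ?extend_rng// extend_src// tail_edge_rng//.
Qed.

Definition shift_fun la y : nat * L := (nf y.1 (kg_comp la y.2)).1.
Definition shift_weight la y : R[i] :=
  if reduced y && (kg_rng y.2 == kg_src la) then c la y.2 * (nf y.1 (kg_comp la y.2)).2 else 0.

Lemma comp_src m la mu : kg_src mu = tail_vertex m -> kg_src la = kg_rng mu ->
  kg_src (kg_comp la mu) = tail_vertex m.
Proof. by move=> s sl; rewrite kg_src_comp. Qed.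

(* [la . e(m, mu) = c(la, mu) e(m, la mu)] for all representatives, not only the
   reduced ones; this is where the cocycle identity enters. *)
Lemma shift_nf m la mu : kg_src mu = tail_vertex m -> kg_src la = kg_rng mu ->
  shift_fun la (nf m mu).1 = (nf m (kg_comp la mu)).1 /\
  (nf m mu).2 * shift_weight la (nf m mu).1 = c la mu * (nf m (kg_comp la mu)).2.
Proof.
have base m' mu' : kg_src mu' = tail_vertex m' -> kg_src la = kg_rng mu' ->
    nf m' mu' = ((m', mu'), 1) -> shift_fun la (m', mu') = (nf m' (kg_comp la mu')).1 /\
    1 * shift_weight la (m', mu') = c la mu' * (nf m' (kg_comp la mu')).2.
  move=> s sl E; split=> //; rewrite mul1r /shift_weight /= sl eqxx andbT.
  by rewrite (_ : reduced _)//; apply/asboolP.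
elim: m mu => [|m IH] mu s sl; first exact: base.
case: (nf_caseP m mu) s sl => [eta se _ sl|nu nE s sl]; last by rewrite nE; exact: base.
have sx : kg_src eta = kg_rng (tail_edge m) by rewrite tail_edge_rng.
have sle : kg_src la = kg_rng eta by rewrite sl kg_rng_comp.
rewrite nf_comp// kg_compA// nf_comp ?(comp_src se sle)//.
have [H1 H2] := IH _ se sle; split; first exact: H1.
rewrite [LHS]/= [X in _ = _ * X]/=.
(* The cocycle identity for [la], [eta] and the tail edge, solved for [c la eta]. *)
have coc : c la eta = c eta (tail_edge m) * c la (kg_comp eta (tail_edge m)) *
    Num.conj (c (kg_comp la eta) (tail_edge m)).
  have sle' : kg_src (kg_comp la eta) = kg_rng (tail_edge m) by rewrite kg_src_comp.
  by have [_ _ H3] := c_cocycle; rewrite -H3// -mulrA conj_cocycleK// mulr1.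
rewrite mulrAC H2 coc -[RHS]mul1r -(conj_cocycleK sx) /=; ring.
Qed.

Lemma shift_weight_neq0 la y : shift_weight la y != 0 ->
  [/\ kg_src y.2 = tail_vertex y.1, nf y.1 y.2 = (y, 1) & kg_src la = kg_rng y.2].
Proof.
rewrite /shift_weight; case: ifP => [/andP[/asboolP[H1 H2] /eqP H3] _|_]; last by rewrite eqxx.
by split.
Qed.

Lemma shift_weightE la y : kg_src y.2 = tail_vertex y.1 -> nf y.1 y.2 = (y, 1) ->
  kg_src la = kg_rng y.2 -> shift_weight la y = c la y.2 * (nf y.1 (kg_comp la y.2)).2.
Proof.
move=> s E sl; rewrite /shift_weight sl eqxx andbT (_ : reduced y)//.
by apply/asboolP.
Qed.

Lemma shift_weight_norm1 la y : kg_src y.2 = tail_vertex y.1 -> nf y.1 y.2 = (y, 1) ->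
  kg_src la = kg_rng y.2 -> `|shift_weight la y| = 1.
Proof.
move=> s E sl; rewrite shift_weightE// normrM.
have [_ _ ->] := nf_reduced (comp_src s sl).
by case: c_cocycle => -> //; rewrite mulr1.
Qed.

Lemma shift_weight_unimodular la y : shift_weight la y != 0 -> `|shift_weight la y| = 1.
Proof. by case/shift_weight_neq0 => s E sl; exact: shift_weight_norm1. Qed.

Lemma shift_weight_support la y : kg_src y.2 = tail_vertex y.1 -> nf y.1 y.2 = (y, 1) ->
  kg_src la = kg_rng y.2 -> shift_weight la y != 0.
Proof. by move=> s E sl; rewrite -normr_eq0 shift_weight_norm1// oner_eq0. Qed.

(** Both pairs are raised to the common level [y.1 + y'.1], where [nf_inj] turns the equality into
    one of paths and unique factorisation splits it. With [la = la'] this makes [shift_fun la]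
    injective on its domain; otherwise it makes the ranges disjoint. *)
Lemma shift_fun_inj2 la la' y y' : kg_deg la = kg_deg la' ->
  shift_weight la y != 0 -> shift_weight la' y' != 0 ->
  shift_fun la y = shift_fun la' y' -> la = la' /\ y = y'.
Proof.
move=> d /shift_weight_neq0[s E sl] /shift_weight_neq0[s' E' sl'] e.
have lift m mu j la1 : kg_src mu = tail_vertex m -> kg_src la1 = kg_rng mu ->
    (nf (m + j) (kg_comp la1 (extend m mu j))).1 = (nf m (kg_comp la1 mu)).1.
  by move=> s1 sl1; rewrite -extend_comp// nf_extend//; exact: comp_src.
have ee : kg_comp la (extend y.1 y.2 y'.1) = kg_comp la' (extend y'.1 y'.2 y.1).
  apply: (@nf_inj (y.1 + y'.1)%N).
  - by rewrite kg_src_comp ?extend_rng// extend_src.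
  - by rewrite kg_src_comp ?extend_rng// extend_src// addnC.
  by rewrite lift// addnC lift.
have [||ll ze] := kg_cancel _ _ d ee; rewrite ?extend_rng//; split=> //.
have := nf_extend y'.1 s; rewrite ze E /= addnC nf_extend// E' /=.
by move=> ->.
Qed.

Lemma shift_fun_inj la y y' : shift_weight la y != 0 -> shift_weight la y' != 0 ->
  shift_fun la y = shift_fun la y' -> y = y'.
Proof. by move=> w w' /(shift_fun_inj2 erefl w w')[]. Qed.

Definition path_op la : bop R (nat * L)%type :=
  push_bop (@shift_weight_unimodular la) (@shift_fun_inj la).

Definition path_star_op la : bop R (nat * L)%type :=
  pull_bop (@shift_weight_unimodular la) (@shift_fun_inj la).

Local Notation lpush la := (push (shift_weight la) (shift_fun la)).
Local Notation lpull la := (pull (shift_weight la) (shift_fun la)).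

Lemma path_opE la (u : ell2 R (nat * L)%type) x :
  ell2_val (path_op la u) x = lpush la (ell2_val u) x.
Proof. by []. Qed.

Lemma path_op_star la : (path_op la)^† = path_star_op la.
Proof. exact: push_bop_star. Qed.

Lemma path_star_opE la (u : ell2 R (nat * L)%type) x :
  ell2_val (path_star_op la u) x = lpull la (ell2_val u) x.
Proof. by []. Qed.

Lemma path_mulE (S T : bop R (nat * L)%type) u : (S ** T) u = S (T u).
Proof. by []. Qed.

Definition in_vertex v y : bool := reduced y && (kg_rng y.2 == v).

Lemma shift_weight_vertex v y : shift_weight (kg_id v) y = (in_vertex v y)%:R.
Proof.
rewrite /shift_weight kg_src_id -/(in_vertex v y); case: ifP => // /andP[/asboolP[s E] /eqP rv].
rewrite -rv kg_comp_idl E /= mulr1; case: c_cocycle => _ H _; apply: H.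
  by rewrite /composable kg_src_id.
by left; rewrite kg_deg_id.
Qed.

Lemma shift_fun_vertex v y : in_vertex v y -> shift_fun (kg_id v) y = y.
Proof.
by case/andP => /asboolP[s E] /eqP <-; rewrite /shift_fun kg_comp_idl E.
Qed.

Lemma path_op_vertex v (u : ell2 R (nat * L)%type) x :
  ell2_val (path_op (kg_id v) u) x = (in_vertex v x)%:R * ell2_val u x.
Proof.
rewrite path_opE; case: (boolP (in_vertex v x)) => vx.
  have w : shift_weight (kg_id v) x != 0 by rewrite shift_weight_vertex vx oner_eq0.
  rewrite -{1}(shift_fun_vertex vx) push_image//; last exact: shift_fun_inj.
  by rewrite shift_weight_vertex vx.
rewrite mul0r push_eq0// => y; rewrite shift_weight_vertex.
case: (boolP (in_vertex v y)) => [vy _|_]; last by rewrite eqxx.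
by rewrite shift_fun_vertex// => yx; move: vx; rewrite -yx vy.
Qed.

Lemma path_star_op_vertex v (u : ell2 R (nat * L)%type) x :
  ell2_val (path_star_op (kg_id v) u) x = (in_vertex v x)%:R * ell2_val u x.
Proof.
rewrite path_star_opE /pull shift_weight_vertex.
case: (boolP (in_vertex v x)) => vx; last by rewrite rmorph0 !mul0r.
by rewrite rmorph1 !mul1r shift_fun_vertex.
Qed.

(** Applied to the representative [(y.1, nu y.2)] before reduction, [shift_nf] moves [mu] past the
    normal form; the cocycle identity for [mu], [nu] and [y.2] then matches the phases. *)
Lemma path_op_comp mu nu : kg_src mu = kg_rng nu ->
  path_op mu ** path_op nu = c mu nu *: path_op (kg_comp mu nu).
Proof.
move=> smn; apply: bop_eq => u; apply: ell2_eq => x; rewrite path_mulE path_opE.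
have -> : ell2_val ((c mu nu *: path_op (kg_comp mu nu)) u) x =
  c mu nu * lpush (kg_comp mu nu) (ell2_val u) x by [].
have step y : shift_weight nu y != 0 ->
    [/\ shift_weight (kg_comp mu nu) y != 0, shift_weight mu (shift_fun nu y) != 0,
      shift_fun mu (shift_fun nu y) = shift_fun (kg_comp mu nu) y &
      shift_weight mu (shift_fun nu y) * shift_weight nu y =
        c mu nu * shift_weight (kg_comp mu nu) y].
  move=> /shift_weight_neq0[s E sn].
  have sc : kg_src (kg_comp mu nu) = kg_rng y.2 by rewrite kg_src_comp.
  have sm : kg_src mu = kg_rng (kg_comp nu y.2) by rewrite kg_rng_comp.
  have [H1 H2] := shift_nf (comp_src s sn) sm.
  have [R1 R2 R3] := nf_reduced (comp_src s sn).
  split.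
  - exact: shift_weight_support.
  - have /asboolP[R4 R5] := R1.
    by apply: shift_weight_support => //; rewrite /shift_fun R2.
  - by rewrite [LHS]H1 /shift_fun kg_compA.
  rewrite (shift_weightE s E sn) (shift_weightE s E sc) mulrCA [shift_weight mu _ * _]mulrC.
  rewrite H2 kg_compA// !mulrA; congr (_ * _).
  by case: c_cocycle => _ _ H3; rewrite H3.
have [[y [wy yx]]|nx] := pselect (exists y, shift_weight nu y != 0 /\
    shift_fun (kg_comp mu nu) y = x).
  have [w1 w2 f1 w3] := step y wy.
  rewrite -{1}yx -{1}f1 push_image//; last exact: shift_fun_inj.
  rewrite path_opE push_image//; last exact: shift_fun_inj.
  rewrite -yx push_image//; last exact: shift_fun_inj.
  by rewrite !mulrA w3.
have nuw y : shift_weight (kg_comp mu nu) y != 0 -> shift_weight nu y != 0.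
  move=> /shift_weight_neq0[s E]; rewrite kg_src_comp// => sn.
  exact: shift_weight_support.
rewrite [X in _ * X]push_eq0 ?mulr0; last first.
  by move=> y /nuw wy yx; apply: nx; exists y.
rewrite {1}/push; case E: partial_inv => [z|//]; have [wz zx] := partial_invP E.
rewrite path_opE push_eq0 ?mulr0// => y wy yz.
have [_ _ f1 _] := step y wy.
by apply: nx; exists y; split=> //; rewrite -f1 yz.
Qed.

Lemma path_op_starM la : (path_op la)^† ** path_op la = path_op (kg_id (kg_src la)).
Proof.
rewrite path_op_star; apply: bop_eq => u; apply: ell2_eq => x.
rewrite path_mulE path_op_vertex path_star_opE -[X in lpull la X]/(lpush la (ell2_val u)).
rewrite pull_push; [|exact: shift_weight_unimodular|exact: shift_fun_inj].
rewrite /shift_weight -/(in_vertex (kg_src la) x).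
have [vx|vx] := boolP (in_vertex (kg_src la) x); last by rewrite eqxx mul0r.
have /andP[/asboolP[s E] /eqP r] := vx.
by rewrite -shift_weightE// (negPf (shift_weight_support s E (esym r))) mul1r.
Qed.

Lemma path_range_projection la (u : ell2 R (nat * L)%type) x :
  ell2_val ((path_op la ** (path_op la)^†) u) x =
  if partial_inv (shift_weight la) (shift_fun la) x then ell2_val u x else 0.
Proof.
rewrite path_op_star path_mulE path_opE -[X in lpush la X]/(lpull la (ell2_val u)).
by rewrite push_pull; last exact: shift_weight_unimodular.
Qed.

Lemma path_op_sum v (n : {ffun 'I_k -> nat}) :
  path_op (kg_id v) = \sum_(la \in paths_to v n) path_op la ** (path_op la)^†.
Proof.
rewrite fsbig_finite; last exact: L_row_finite.
apply: bop_eq => u; apply: ell2_eq => x.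
have -> : forall s : seq L, ell2_val ((\sum_(la <- s) path_op la ** (path_op la)^†) u) x =
    \sum_(la <- s) (if partial_inv (shift_weight la) (shift_fun la) x then ell2_val u x else 0).
  elim=> [|la s IH]; first by rewrite !big_nil.
  by rewrite !big_cons -IH -path_range_projection.
rewrite path_op_vertex.
have inR la : partial_inv (shift_weight la) (shift_fun la) x ->
    exists2 y, shift_weight la y != 0 & shift_fun la y = x.
  by case E: partial_inv => [y|//] _; have [wy yx] := partial_invP E; exists y.
(* All operators involved are diagonal: exactly one summand contributes at a reduced [x] with range
   [v], and none does elsewhere. *)
case: (boolP (in_vertex v x)) => [/andP[/asboolP[s E] /eqP rv]|vx]; last first.
  rewrite mul0r big1_seq// => la /andP[_]; rewrite mem_paths_to// => /andP[/eqP rla _].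
  case: ifP => // /inR[y /shift_weight_neq0[s E sl] yx].
  have [R1 R2 _] := nf_reduced (comp_src s sl).
  by case/negP: vx; rewrite -yx /in_vertex R1 R2 kg_rng_comp// rla eqxx.
(* The path [x.2] may be too short to split off a piece of degree [n]; its representative [j] levels
   higher has degree at least [n], and its initial piece [la] gives the one summand that
   contributes. *)
rewrite mul1r; pose j := \max_i n i.
have nj i : (n i <= j)%N by exact: (leq_bigmax_cond (F := fun i => n i)).
pose xi := extend x.1 x.2 j.
have dxi : kg_deg xi = n + [ffun i => (kg_deg xi i - n i)%N].
  apply/ffunP => i; rewrite deg_addE [[ffun _ => _] i]ffunE subnKC//.
  by rewrite /xi extend_deg// deg_addE cst_degE (leq_trans (nj i))// leq_addl.
have [[la ze] [[/= dla _ sla xiE] _]] := kg_factorisation dxi.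
have sze : kg_src ze = tail_vertex (x.1 + j).
  by rewrite -(kg_src_comp sla) -xiE extend_src.
pose y := (nf (x.1 + j) ze).1.
have [/asboolP[R1 R2] R3 _] := nf_reduced sze.
have wy : shift_weight la y != 0 by apply: shift_weight_support => //; rewrite /y R3.
have fy : shift_fun la y = x.
  by have [-> _] := shift_nf sze sla; rewrite -xiE nf_extend// E.
have rla : kg_rng la = v by rewrite -(kg_rng_comp sla) -xiE extend_rng.
rewrite (bigD1_seq la)/=; [|by rewrite mem_paths_to// rla dla !eqxx|exact: fset_uniq].
rewrite -{2}fy partial_invK//; last exact: shift_fun_inj.
rewrite big1_seq ?addr0// => la' /andP[ll]; rewrite mem_paths_to// => /andP[_ /eqP dla'].
case: ifP => // /inR[y' wy' fy']; case/eqP: ll.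
have dd : kg_deg la' = kg_deg la by rewrite dla' dla.
by have [] := shift_fun_inj2 dd wy' wy (etrans fy' (esym fy)).
Qed.

Lemma path_op_family : ck_family c path_op.
Proof.
split.
- split=> [v|v w vw]; first split.
  + apply: bop_eq => u; apply: ell2_eq => x; rewrite path_mulE !path_op_vertex.
    by case: in_vertex; rewrite ?mul1r ?mul0r.
  + rewrite path_op_star; apply: bop_eq => u; apply: ell2_eq => x.
    by rewrite path_op_vertex path_star_op_vertex.
  + apply: bop_eq => u; apply: ell2_eq => x; rewrite path_mulE !path_op_vertex.
    rewrite /in_vertex; case: (reduced x); rewrite ?mul0r//=.
    have [rv|] := eqVneq (kg_rng x.2) v; last by rewrite mul0r.
    have [rw|] := eqVneq (kg_rng x.2) w; last by rewrite mul0r mulr0.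
    by case: vw; rewrite -rv -rw.
- by move=> mu nu; exact: path_op_comp.
- exact: path_op_starM.
- exact: path_op_sum.
Qed.

Lemma path_op_neq0 : path_op (kg_id v0) <> 0.
Proof.
pose y0 : nat * L := (0%N, kg_id v0).
have sq : square_summable (fun y => (y == y0)%:R : R[i]).
  exists 1 => s us; rewrite /dot_on.
  have [ys|ys] := boolP (y0 \in s).
    rewrite (bigD1_seq y0)//= big1 ?addr0 => [|y /negPf->]; first by rewrite eqxx /cdot/= mulr1 mulr0 addr0.
    by rewrite /cdot/= !mulr0 addr0.
  rewrite big1_seq// => y /andP[_ yins]; have [e|] := eqVneq y y0.
    by rewrite e in yins; rewrite yins in ys.
  by rewrite /cdot/= !mulr0 addr0.
move=> /(congr1 (fun T : bop R (nat * L)%type => ell2_val (T (ell2_of sq)) y0)).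
rewrite path_op_vertex -[ell2_val (ell2_of sq) y0]/((y0 == y0)%:R : R[i]) eqxx mulr1.
rewrite /in_vertex kg_rng_id eqxx andbT.
have -> : reduced y0 by apply/asboolP; rewrite /= kg_src_id.
by move=> e; have /eqP : (1 : R[i]) = 0 := e; rewrite oner_eq0.
Qed.

End PathSpace.

Theorem corollary7p6 (R : realType) (k : nat) (L : kgraph k)
    (L_row_finite : row_finite L) (L_no_sources : no_sources L)
    (c : L -> L -> R[i]) (c_cocycle : cocycle2 c)
    (A : cstarAlgType R) (s : L -> A) (A_universal : universal_ck_family c s)
    (B : cstarAlgType R) (t : L -> B) (t_family : ck_family c t)
    (gauge_action : exists beta : 'rV[R[i]^o]_k -> B -> B,
       strongly_continuous_action beta /\
       forall (z : 'rV[R[i]^o]_k) (la : L), torus z ->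
         beta z (t la) = torusX z (kg_deg la) *: t la)
    (pi_t : A -> B) (pi_t_hom : star_hom pi_t)
    (pi_t_s : forall la : L, pi_t (s la) = t la) :
  injective pi_t <-> (forall v : kg_vertex L, t (kg_id v) <> 0).
Proof.
have [s_family s_generates s_universal] := A_universal; split.
  move=> pi_inj v tv0.
  have [rho [rho_hom rho_s]] :=
    s_universal _ _ (path_op_family L_row_finite L_no_sources c_cocycle v).
  apply: (@path_op_neq0 R k L c L_no_sources c_cocycle v).
  have sv0 : s (kg_id v) = 0 by apply: pi_inj; rewrite pi_t_s tv0 star_hom0.
  by rewrite -rho_s sv0 star_hom0.
move=> t_neq0; have [beta [[beta_aut _ _ _] beta_t]] := gauge_action.
apply: (gauge_invariant_injective L_row_finite c_cocycle s_family t_family pi_t_hom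
  pi_t_s t_neq0 _ beta_t s_generates).
by move=> z /beta_aut[].
Qed.
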